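(* Let $n\ge 1$ be an integer and let $K$ be a field of arbitrary characteristic, assumed algebraically closed if its characteristic is positive. Let $f\in R=K[[x_1,\dots,x_n]]$ define an isolated hypersurface singularity at the origin. Then $$\frac{\mu(\mathcal{O}_f)}{\tau(f)}\le \frac{1}{\mathcal{H}_{\frac{n+1}{2}}(n)-\mathcal{H}_{\frac{n-1}{2}}(n)}.$$
   Context: Let $R=K[[x_1,\dots,x_n]]$ with maximal ideal $\mathfrak m=(x_1,\dots,x_n)$ and group of units $R^\times$. A hypersurface singularity at the origin is a power series $f\in\mathfrak m^2$. For a power series $f$, put $j(f)=\left(\frac{\partial f}{\partial x_1},\dots,\frac{\partial f}{\partial x_n}\right)$ and $tj(f)=(f)+j(f)$, and define $\mu(f)=\dim_K R/j(f)$ (possibly infinite) and $\tau(f)=\dim_K R/tj(f)$. The hypersurface singularity $f$ is isolated if $\tau(f)<\infty$. The generalized Milnor number of an isolated hypersurface singularity is $\mu(\mathcal{O}_f)=\min\{\mu(uf)\mid u\in R^\times\}$. For real $0\le s\le n$, $\mathcal{H}_s(n)=\sum_{i=0}^{\lfloor s\rfloor}\frac{(-1)^i}{n!}\binom{n}{i}(s-i)^n$; this is the Lebesgue measure of $\{(x_1,\dots,x_n)\in[0,1]^n\mid x_1+\dots+x_n\le s\}$. *)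

(* Defs.v *)
From HB Require Import structures.
From mathcomp Require Import all_boot all_order all_algebra.
From mathcomp Require Import boolp classical_sets reals ereal.
(* The notations of mpoly clash with those of boolp and ereal. *)
From mathcomp Require Import -(notations) mpoly.

Set Implicit Arguments.
Unset Strict Implicit.
Unset Printing Implicit Defensive.

Import Order.TTheory GRing.Theory Num.Theory.

Local Open Scope classical_set_scope.
Local Open Scope ring_scope.


(* A power series is the family of its coefficients, indexed by exponents. *)
Record mfps (n : nat) (K : Type) := MFPS { mfps_coef : multinom n -> K }.

HB.instance Definition _ n K := [isNew for @mfps_coef n K].
HB.instance Definition _ n (K : choiceType) := [Choice of mfps n K by <:].

Section PowerSeriesModule.
Variables (n : nat) (K : comNzRingType).
Implicit Types f g h : mfps n K.
Local Notation coef := (@mfps_coef n K).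

Lemma mfpsP f g : (forall m, coef f m = coef g m) -> f = g.
Proof. by move=> E; apply/val_inj/funext. Qed.

Definition mfps0 : mfps n K := MFPS (fun=> 0).
Definition mfps_opp f := MFPS (fun m => - coef f m).
Definition mfps_add f g := MFPS (fun m => coef f m + coef g m).

Fact mfps_addA : associative mfps_add.
Proof. by move=> f g h; apply: mfpsP => m; rewrite /= addrA. Qed.
Fact mfps_addC : commutative mfps_add.
Proof. by move=> f g; apply: mfpsP => m; rewrite /= addrC. Qed.
Fact mfps_add0 : left_id mfps0 mfps_add.
Proof. by move=> f; apply: mfpsP => m; rewrite /= add0r. Qed.
Fact mfps_addN : left_inverse mfps0 mfps_opp mfps_add.
Proof. by move=> f; apply: mfpsP => m; rewrite /= addNr. Qed.

HB.instance Definition _ := GRing.isZmodule.Build (mfps n K)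
  mfps_addA mfps_addC mfps_add0 mfps_addN.

Definition mfps_scale (c : K) f := MFPS (fun m => c * coef f m).

Fact mfps_scaleA a b f : mfps_scale a (mfps_scale b f) = mfps_scale (a * b) f.
Proof. by apply: mfpsP => m; rewrite /= mulrA. Qed.
Fact mfps_scale1 : left_id 1 mfps_scale.
Proof. by move=> f; apply: mfpsP => m; rewrite /= mul1r. Qed.
Fact mfps_scaleDr : right_distributive mfps_scale +%R.
Proof. by move=> c f g; apply: mfpsP => m; rewrite /= mulrDr. Qed.
Fact mfps_scaleDl f : {morph mfps_scale^~ f : a b / a + b}.
Proof. by move=> a b; apply: mfpsP => m; rewrite /= mulrDl. Qed.

HB.instance Definition _ := GRing.Zmodule_isLmodule.Build K (mfps n K)
  mfps_scaleA mfps_scale1 mfps_scaleDr mfps_scaleDl.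

(* Cauchy product. The exponents k.1 and k.2 with k.1 + k.2 = m range over the
   finite type of exponents of total degree at most that of m. *)
Definition mfps_mul f g := MFPS (fun m =>
  \sum_(k : bmultinom n (mdeg m).+1 * bmultinom n (mdeg m).+1
        | m == mnm_add k.1 k.2) coef f k.1 * coef g k.2).
Definition mfps1 : mfps n K := MFPS (fun m => (m == mnm0)%:R).

Let agree d f (p : mpoly n K) :=
  forall m : multinom n, (mdeg m < d)%N -> coef f m = mcoeff m p.

Let mulE d f g p q : agree d f p -> agree d g q ->
  agree d (mfps_mul f g) (p * q).
Proof.
move=> fp gq m md; rewrite mcoeffM /=; apply: eq_bigr => -[[k1 k1m] [k2 k2m]] _ /=.
by rewrite fp ?gq //; [exact: leq_trans k2m md | exact: leq_trans k1m md].
Qed.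

Let trunc d f : mpoly n K :=
  \sum_(m : bmultinom n d) coef f m *: mpolyX K m.

Let agree_trunc d f : agree d f (trunc d f).
Proof. by move=> m md; rewrite mcoeff_mpoly. Qed.

Let agree1 d : agree d mfps1 1.
Proof. by move=> m _; rewrite mcoeff1. Qed.

Fact mfps_mulA : associative mfps_mul.
Proof.
move=> f g h; apply: mfpsP => m; have T := @agree_trunc (mdeg m).+1.
rewrite (mulE (T f) (mulE (T g) (T h)) (ltnSn _)) mulrA.
by rewrite (mulE (mulE (T f) (T g)) (T h) (ltnSn _)).
Qed.
Fact mfps_mulC : commutative mfps_mul.
Proof.
move=> f g; apply: mfpsP => m; have T := @agree_trunc (mdeg m).+1.
by rewrite (mulE (T f) (T g) (ltnSn _)) mulrC (mulE (T g) (T f) (ltnSn _)).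
Qed.
Fact mfps_mul1 : left_id mfps1 mfps_mul.
Proof.
move=> f; apply: mfpsP => m; have T := @agree_trunc (mdeg m).+1.
by rewrite (mulE (@agree1 _) (T f) (ltnSn _)) mul1r -T.
Qed.
Fact mfps_mulD : left_distributive mfps_mul +%R.
Proof.
move=> f g h; apply: mfpsP => m /=; rewrite -big_split /=.
by apply: eq_bigr => k _; rewrite mulrDl.
Qed.
Fact mfps1_neq0 : mfps1 != 0.
Proof.
apply/eqP => /(congr1 (fun f => coef f mnm0)) /=.
by rewrite eqxx => /eqP; rewrite oner_eq0.
Qed.

HB.instance Definition _ := GRing.Zmodule_isComNzRing.Build (mfps n K)
  mfps_mulA mfps_mulC mfps_mul1 mfps_mulD mfps1_neq0.

Fact mfps_scaleAl (c : K) f g : c *: (f * g) = (c *: f) * g.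
Proof.
apply: mfpsP => m /=; rewrite big_distrr /=.
by apply: eq_bigr => k _; rewrite mulrA.
Qed.

HB.instance Definition _ :=
  GRing.Lmodule_isLalgebra.Build K (mfps n K) mfps_scaleAl.
HB.instance Definition _ := GRing.Lalgebra_isComAlgebra.Build K (mfps n K).

Definition mfps_unit : pred (mfps n K) := fun f => `[< exists g, g * f = 1 >].
Definition mfps_inv f : mfps n K :=
  if pselect (exists g, g * f = 1) is left e then projT1 (cid e) else f.

Fact mfps_mulV : {in mfps_unit, left_inverse 1 mfps_inv *%R}.
Proof.
move=> f /asboolP fu; rewrite /mfps_inv; case: pselect => // e.
by case: (cid e).
Qed.
Fact mfps_unitP f g : g * f = 1 -> mfps_unit f.
Proof. by move=> gf; apply/asboolP; exists g. Qed.
Fact mfps_inv_out : {in [predC mfps_unit], mfps_inv =1 id}.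
Proof.
by move=> f /asboolP fu; rewrite /mfps_inv; case: pselect => //.
Qed.

HB.instance Definition _ := GRing.ComNzRing_hasMulInverse.Build (mfps n K)
  mfps_mulV mfps_unitP mfps_inv_out.

Definition mfps_X (i : 'I_n) : mfps n K := MFPS (fun m => (m == mnm1 i)%:R).

(* The coefficient of x^m in the i-th partial derivative of f is
   (m_i + 1) times the coefficient of x^(m + e_i) in f. *)
Definition mfps_deriv (i : 'I_n) f : mfps n K :=
  MFPS (fun m => coef f (mnm_add m (mnm1 i)) *+ (m i).+1).

End PowerSeriesModule.

Definition ideal_gen (A : comNzRingType) (s : seq A) : set A :=
  [set a | exists c : 'I_(size s) -> A, a = \sum_(i < size s) c i * s`_i].

Definition ideal_add (A : comNzRingType) (I J : set A) : set A :=
  [set a + b | a in I & b in J].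

Definition ideal_mul (A : comNzRingType) (I J : set A) : set A :=
  [set a | exists s : seq (A * A),
     (forall p, p \in s -> I p.1 /\ J p.2) /\ a = \sum_(p <- s) p.1 * p.2].

Section QuotientDimension.
Variables (K : fieldType) (V : lmodType K).

(* The classes of e_0, ..., e_(d-1) form a K-basis of V / I. *)
Definition quot_basis (I : set V) (d : nat) (e : 'I_d -> V) : Prop :=
  forall v : V, exists! c : 'rV[K]_d, I (v - \sum_(i < d) c 0 i *: e i).

(* dim_K (V / I) for a K-subspace I; well defined by quot_basis_card. *)
Definition quot_dim (R : realType) (I : set V) : \bar R :=
  if pselect (exists d (e : 'I_d -> V), quot_basis I e) is left h
  then ((projT1 (cid h))%:R)%:E else +oo%E.

Lemma quot_basis_card (I : set V) d1 d2 (e1 : 'I_d1 -> V) (e2 : 'I_d2 -> V) :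
  I 0 -> (forall a u v, I u -> I v -> I (a *: u + v)) ->
  quot_basis I e1 -> quot_basis I e2 -> d1 = d2.
Proof.
move=> I0 IL B1 B2.
have ID u v : I u -> I v -> I (u + v) by rewrite -{2}[u]scale1r; exact: IL.
have IZ a u : I u -> I (a *: u) by move=> Iu; rewrite -[_ *: _]addr0; exact: IL.
have Isum (J : finType) (F : J -> V) : (forall j, I (F j)) -> I (\sum_j F j).
  by move=> IF; elim/big_rec: _ => // j v _; exact: ID.
suff key : forall d d' (e : 'I_d -> V) (e' : 'I_d' -> V),
    quot_basis I e -> quot_basis I e' -> (d <= d')%N.
  by apply/eqP; rewrite eqn_leq (key _ _ _ _ B1 B2) (key _ _ _ _ B2 B1).
move=> {d1 d2 e1 e2 B1 B2} d d' e e' B B'.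
have /choice[P HP] i : exists c : 'rV[K]_d',
    I (e i - \sum_(j < d') c 0 j *: e' j) by case: (B' (e i)) => c []; exists c.
have /choice[Q HQ] i : exists c : 'rV[K]_d,
    I (e' i - \sum_(j < d) c 0 j *: e j) by case: (B (e' i)) => c []; exists c.
pose M := \matrix_(i < d, j < d') P i 0 j.
pose N := \matrix_(i < d', j < d) Q i 0 j.
suff MN : M *m N = 1%:M.
  by rewrite -(mxrank1 K d) -MN (leq_trans (mxrankM_maxl _ _)) ?rank_leq_col.
apply/row_matrixP => i; case: (B (e i)) => c [_ cu].
rewrite -(cu (row i (M *m N))) ?(cu (row i 1%:M)) //.
- rewrite (_ : \sum_(_ < _) _ = e i) ?subrr // (bigD1 i) //= big1 ?addr0.
    by rewrite !mxE eqxx scale1r.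
  by move=> j ji; rewrite !mxE eq_sym (negbTE ji) scale0r.
- have -> : \sum_(j < d) row i (M *m N) 0 j *: e j =
      \sum_(k < d') P i 0 k *: \sum_(j < d) Q k 0 j *: e j.
    under [RHS]eq_bigr do rewrite scaler_sumr.
    rewrite exchange_big /=; apply: eq_bigr => j _.
    rewrite !mxE scaler_suml; apply: eq_bigr => k _.
    by rewrite !mxE scalerA.
  rewrite -[e i](subrK (\sum_(k < d') P i 0 k *: e' k)) -addrA.
  apply: ID; first exact: HP.
  rewrite -sumrB; apply: Isum => k; rewrite -scalerBr; exact: IZ.
Qed.

Lemma quot_dimE (R : realType) (I : set V) d (e : 'I_d -> V) :
  I 0 -> (forall a u v, I u -> I v -> I (a *: u + v)) ->
  quot_basis I e -> quot_dim R I = (d%:R)%:E.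
Proof.
move=> I0 IL B; rewrite /quot_dim; case: pselect => [h|[]]; last by exists d, e.
by case: cid => d' [e' B'] /=; rewrite (quot_basis_card I0 IL B' B).
Qed.

End QuotientDimension.

Section Singularities.
Variables (n : nat) (K : fieldType).
Implicit Types f u : mfps n K.

Definition maxideal : set (mfps n K) :=
  ideal_gen [seq mfps_X K i | i <- enum 'I_n].

Definition jac f : set (mfps n K) :=
  ideal_gen [seq mfps_deriv i f | i <- enum 'I_n].

Definition tjac f : set (mfps n K) := ideal_add (ideal_gen [:: f]) (jac f).

Definition hypersurface_singularity f : Prop :=
  ideal_mul maxideal maxideal f.

Variable R : realType.

Definition milnor f : \bar R := quot_dim R (jac f).

Definition tjurina f : \bar R := quot_dim R (tjac f).

Definition isolated_singularity f : Prop :=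
  hypersurface_singularity f /\ (tjurina f < +oo)%E.

(* The infimum is a minimum: see gen_milnor_attained. *)
Definition gen_milnor f : \bar R :=
  ereal_inf [set milnor (u * f) | u in [set u | u \is a GRing.unit]].

Lemma gen_milnor_attained f :
  (exists2 u, u \is a GRing.unit & gen_milnor f = milnor (u * f)) /\
  (forall u, u \is a GRing.unit -> (gen_milnor f <= milnor (u * f)%R)%E).
Proof.
have lb u : u \is a GRing.unit -> (gen_milnor f <= milnor (u * f)%R)%E.
  by move=> uu; apply: ereal_inf_lbound; exists u.
split=> //.
suff [u uu um] : exists2 u, u \is a GRing.unit &
    forall v, v \is a GRing.unit -> (milnor (u * f)%R <= milnor (v * f)%R)%E.
  exists u => //; apply/eqP; rewrite eq_le lb //=.
  by apply: le_ereal_inf_tmp => _ [v vu <-]; exact: um.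
pose P d := `[< exists2 u, u \is a GRing.unit & milnor (u * f) = (d%:R)%:E >].
have val u : milnor (u * f) = +oo%E \/ exists d, milnor (u * f) = (d%:R)%:E.
  by rewrite /milnor /quot_dim; case: pselect => [h|_]; [right; eexists|left].
have [exP|nP] := pselect (exists d, P d).
- case: (ex_minnP exP) => d /asboolP[u uu du] dmin; exists u => // v vu.
  have [->|[d' d'v]] := val v; first exact: leey.
  rewrite du d'v lee_fin ler_nat; apply: dmin; apply/asboolP; by exists v.
- exists 1; first exact: unitr1.
  move=> v vu; have [->|[d dv]] := val v; first exact: leey.
  by case: nP; exists d; apply/asboolP; exists v.
Qed.

End Singularities.

(* Lebesgue measure of {x in [0,1]^n | x_1 + ... + x_n <= s} for 0 <= s <= n,
   where Num.truncn s is the floor of s. *)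
Definition cube_vol (R : realType) (n : nat) (s : R) : R :=
  \sum_(0 <= i < (Num.truncn s).+1)
     (-1) ^+ i / n`!%:R * 'C(n, i)%:R * (s - i%:R) ^+ n.

(* Main.v *)
From HB Require Import structures.
Require Import Defs.
From mathcomp Require Import all_boot all_order all_algebra.
From mathcomp Require Import boolp classical_sets reals ereal.
From mathcomp Require Import -(notations) mpoly.
From mathcomp Require Import closed_field.
From mathcomp Require Import ring lra zify.

(* Let I = tj f and let J = (g_1, ..., g_n) = j(uf) for a unit u, so that
   I = J + (f).  The n + 1 generators of I satisfy a homogeneous relation over K
   modulo m I^d (they have too many monomials to be independent), and since K is
   infinite a suitable linear u turns it into I^(d+1) = J I^d.  In particular
   dim R / J is finite and f^(k+d) lies in J^k for all k.

   In characteristic p with K perfect, put q = p^e.  As R is free over its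
   subring of q-th powers, on the x^b with b in [0,q)^n, raising generators to
   the q-th power multiplies colengths by q^n.  Write A = R / (g_1^q, ..., g_n^q),
   of dimension q^n mu.  A basis of R / J times the g^a with a in the box
   [0,q)^n spans A, compatibly with the powers of J.  Multiplication by f^q
   sends J^t into J^(t+q-d), so its image in A is spanned by mu elements for
   each a with |a| < t or |a| >= t+q-d, while its cokernel has dimension at most
   q^n tau.  Hence mu times the number of box points with t <= |a| < t+q-d is at
   most q^n tau; for t = (n-1)q/2 and e -> oo, this gives the theorem.

   In characteristic 0 the inputs of this argument are equations between
   finitely many elements of K, so they specialize to a field of some positive
   characteristic. *)

Set Implicit Arguments.
Unset Strict Implicit.
Unset Printing Implicit Defensive.

Import Order.TTheory GRing.Theory Num.Theory.

Local Open Scope classical_set_scope.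
Local Open Scope ring_scope.

(** * Ideals and codimension *)

(** Every colength is bounded from one side only, so regular sequences, multiplicities and Hilbert
    polynomials never appear. In characteristic p an independent family of q^n mu elements modulo
    the g_i^q is compared with a family that is only known to span; the difference of their sizes is
    the count of omitted box points. The exponent d belongs to one fixed relation, hence does not
    depend on q and disappears after division by q^n. The choice of t centres the slab at nq/2,
    where the box is most populated; rescaled, it is the part of the unit cube with coordinate sum
    between (n-1)/2 and (n+1)/2.

    Derivatives matter only for producing u. Afterwards the data are n series g_i and an f with
    f^(d+1) in J I^d, and such data specialize without having to remain a Jacobian ideal: spanning
    modulo I amounts to explicit equations and independence modulo J is certified by dual linear
    forms, so under specialization tau cannot grow and mu cannot drop. Truncation at a power of m
    makes these certificates finite. Of the closedness of K two consequences serve: enough scalars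
    to choose u, and p-th roots. *)

Section Ideals.
Variable A : comNzRingType.
Implicit Types (I J S : set A).

Definition is_ideal I : Prop :=
  [/\ I 0, forall a b, I a -> I b -> I (a + b) & forall c a, I a -> I (c * a)].

(** Indexing by a finite type lets [option] adjoin f to the g_i, and products or exponent vectors
    index the generators of products and powers of ideals. *)
Definition idl (T : finType) (h : T -> A) : set A :=
  [set a | exists c : T -> A, a = \sum_t c t * h t].

Fixpoint ipow I s : set A := if s is s'.+1 then ideal_mul I (ipow I s') else setT.

Lemma ideal_sum I (T : Type) (r : seq T) (P : pred T) (F : T -> A) :
  is_ideal I -> (forall t, P t -> I (F t)) -> I (\sum_(t <- r | P t) F t).
Proof. by case=> I0 ID _ IF; elim/big_rec: _ => // t v Pt; apply: ID; exact: IF. Qed.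

Lemma idealN I a : is_ideal I -> I a -> I (- a).
Proof. by case=> _ _ IM Ia; rewrite -mulN1r; exact: IM. Qed.

Lemma idealB I a b : is_ideal I -> I a -> I b -> I (a - b).
Proof. by move=> iI Ia Ib; case: (iI) => _ ID _; apply: ID => //; exact: idealN. Qed.

Lemma idl_ideal (T : finType) (h : T -> A) : is_ideal (idl h).
Proof.
split.
- by exists (fun=> 0); rewrite big1 // => t _; rewrite mul0r.
- move=> _ _ [c ->] [d ->]; exists (fun t => c t + d t).
  by rewrite -big_split; apply: eq_bigr => t _; rewrite mulrDl.
- move=> x _ [c ->]; exists (fun t => x * c t).
  by rewrite mulr_sumr; apply: eq_bigr => t _; rewrite mulrA.
Qed.

Lemma idl_gen (T : finType) (h : T -> A) t : idl h (h t).
Proof.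
exists (fun t' => (t' == t)%:R); rewrite (bigD1 t) //= eqxx mul1r big1 ?addr0 //.
by move=> j /negbTE ->; rewrite mul0r.
Qed.

Lemma idl_min (T : finType) (h : T -> A) S :
  is_ideal S -> (forall t, S (h t)) -> idl h `<=` S.
Proof.
by move=> iS Sh _ [c ->]; apply: ideal_sum => // t _; case: iS => _ _; apply.
Qed.

Lemma ideal_gen_idl (T : finType) (h : T -> A) :
  ideal_gen [seq h t | t <- enum T] = idl h.
Proof.
rewrite eqEsubset; split=> a [c ->].
- apply: ideal_sum => [|i _]; first exact: idl_ideal.
  have [_ _] := idl_ideal h; apply.
  have iT : (i < size (enum T))%N by rewrite -(size_map h).
  have [t0 _] : exists t : T, True by case: (enum T) i iT => [|t l] // i _; exists t.
  by rewrite (nth_map t0) //; exact: idl_gen.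
- pose T0 := size [seq h t | t <- enum T].
  have sT : T0 = #|T| by rewrite /T0 size_map -cardE.
  exists (fun i => c (enum_val (cast_ord sT i))).
  rewrite [LHS](reindex_onto (fun i : 'I_T0 => enum_val (cast_ord sT i))
                 (fun t => cast_ord (esym sT) (enum_rank t))) /=; last first.
    by move=> t _; rewrite cast_ordKV enum_rankK.
  apply: eq_big => [i|i _]; first by rewrite enum_valK cast_ordK eqxx.
  congr (_ * _); rewrite (nth_map (enum_val (cast_ord sT i))).
    by rewrite /enum_val; congr h; apply: set_nth_default; rewrite -cardE ltn_ord.
  by rewrite -(size_map h).
Qed.

Lemma ideal_addl I J : is_ideal J -> I `<=` ideal_add I J.
Proof. by case=> J0 _ _ a Ia; exists a => //; exists 0 => //; rewrite addr0. Qed.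

Lemma ideal_addr I J : is_ideal I -> J `<=` ideal_add I J.
Proof. by case=> I0 _ _ a Ja; exists 0 => //; exists a => //; rewrite add0r. Qed.

Lemma ideal_add_ideal I J : is_ideal I -> is_ideal J -> is_ideal (ideal_add I J).
Proof.
move=> [I0 ID IM] [J0 JD JM]; split.
- by exists 0 => //; exists 0; rewrite ?addr0.
- move=> _ _ [a Ia [b Jb <-]] [a' Ia' [b' Jb' <-]].
  by exists (a + a'); [exact: ID|exists (b + b'); [exact: JD|rewrite addrACA]].
- move=> c _ [a Ia [b Jb <-]].
  by exists (c * a); [exact: IM|exists (c * b); [exact: JM|rewrite mulrDr]].
Qed.

Lemma ideal_mulI I J a b : I a -> J b -> ideal_mul I J (a * b).
Proof.
by move=> Ia Jb; exists [:: (a, b)]; split=> [p|]; rewrite ?inE ?big_seq1 // => /eqP ->.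
Qed.

Lemma ideal_mul_min I J S : is_ideal S ->
  (forall a b, I a -> J b -> S (a * b)) -> ideal_mul I J `<=` S.
Proof.
move=> iS Sab _ [s [sIJ ->]]; rewrite big_seq; apply: ideal_sum => // p /sIJ[].
exact: Sab.
Qed.

Lemma ideal_mul_ideal I J : is_ideal J -> is_ideal (ideal_mul I J).
Proof.
case=> J0 JD JM; split.
- by exists [::]; split=> //; rewrite big_nil.
- move=> _ _ [s [sP ->]] [t [tP ->]]; exists (s ++ t); rewrite big_cat.
  by split=> // p; rewrite mem_cat => /orP[/sP|/tP].
- move=> c _ [s [sP ->]]; exists [seq (p.1, c * p.2) | p <- s]; split.
    by move=> _ /mapP[p /sP[Ip Jp] ->]; split=> //; exact: JM.
  by rewrite big_map mulr_sumr; apply: eq_bigr => p _ /=; rewrite mulrCA.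
Qed.

Lemma ipow_ideal I s : is_ideal (ipow I s).
Proof. by elim: s => [|s IHs] //=; exact: ideal_mul_ideal. Qed.

Lemma colon_ideal S a : is_ideal S -> is_ideal [set b | S (a * b)].
Proof.
case=> S0 SD SM; split=> /= [|b c Sb Sc|c b Sb]; first by rewrite mulr0.
- by rewrite mulrDr; exact: SD.
- by rewrite mulrCA; exact: SM.
Qed.

Lemma ipowD I s t a b : ipow I s a -> ipow I t b -> ipow I (s + t) (a * b).
Proof.
move=> + tb; elim: s a => [|s IHs] a /=.
  by move=> _; have [_ _] := ipow_ideal I t; exact.
have iS := colon_ideal b (ipow_ideal I (s + t).+1).
rewrite mulrC; apply: (ideal_mul_min iS) => x y Ix sy /=.
by rewrite mulrCA; apply: ideal_mulI => //; rewrite mulrC; exact: IHs.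
Qed.

Lemma ipow_sub I J s : I `<=` J -> ipow I s `<=` ipow J s.
Proof.
move=> IJ; elim: s => [|s IHs] //=; apply: ideal_mul_min.
  exact: (ipow_ideal J s.+1).
by move=> a b Ia sb; apply: ideal_mulI; [exact: IJ|exact: IHs].
Qed.

Lemma ipow_le I s t : (s <= t)%N -> ipow I t `<=` ipow I s.
Proof.
move=> /subnKC <-; elim: (t - s)%N => [|k IHk]; rewrite ?addn0 // addnS /=.
apply: ideal_mul_min; first exact: ipow_ideal.
by move=> a b _ /IHk; have [_ _] := ipow_ideal I s; exact.
Qed.

Lemma ipow1 I : is_ideal I -> ipow I 1 = I.
Proof.
move=> iI; rewrite eqEsubset; split=> [|a Ia] /=.
  apply: ideal_mul_min => // a b Ia _; rewrite mulrC.
  by case: iI => _ _; apply.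
by rewrite -[a]mulr1; exact: ideal_mulI.
Qed.

Lemma ipowX I s a : I a -> ipow I s (a ^+ s).
Proof. by move=> Ia; elim: s => [|s IHs] //; rewrite exprS; exact: ideal_mulI. Qed.

Lemma ipow_split I s t : ipow I (s + t) `<=` ideal_mul (ipow I s) (ipow I t).
Proof.
have iS u : is_ideal (ideal_mul (ipow I u) (ipow I t)).
  exact/ideal_mul_ideal/ipow_ideal.
elim: s => [|s IHs]; first by move=> a ta; rewrite -[a]mul1r; exact: ideal_mulI.
apply: ideal_mul_min => // a b Ia /IHs.
suff: ideal_mul (ipow I s) (ipow I t) `<=`
    [set b | ideal_mul (ipow I s.+1) (ipow I t) (a * b)].
  by apply.
apply: ideal_mul_min; first exact: colon_ideal.
by move=> x y sx ty /=; rewrite mulrA; apply: ideal_mulI => //; exact: ideal_mulI.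
Qed.

(** Trades a power of m for a power of an ideal of finite colength: m^N inside I gives m^(tN) inside
    I^t. *)
Lemma ipow_mul I s t : ipow I (t * s) `<=` ipow (ipow I s) t.
Proof.
elim: t => [|t IHt] //; rewrite mulSn => a /ipow_split.
apply: ideal_mul_min; first exact: (ipow_ideal _ t.+1).
by move=> x y sx /IHt; exact: ideal_mulI.
Qed.

(** Induction with S generalized: splitting off one generator [h t] replaces S by its colon ideal by
    [h t]. Inclusions of powers are thereby tested on monomials. *)
Lemma ipow_gen_min (T : finType) (h : T -> A) s S : is_ideal S ->
  (forall a : T -> nat, (\sum_t a t)%N = s -> S (\prod_t h t ^+ a t)) ->
  ipow (idl h) s `<=` S.
Proof.
elim: s S => [|s IHs] S iS Sh.
  move=> a _; rewrite -[a]mulr1; have [_ _] := iS; apply.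
  rewrite (_ : 1 = \prod_t h t ^+ 0%N); last by rewrite big1.
  by apply: Sh; rewrite big1.
apply: ideal_mul_min => // x y [c ->] sy.
rewrite mulr_suml; apply: ideal_sum => // t _; rewrite -mulrA.
have [_ _] := iS; apply; apply: (IHs [set y | S (h t * y)]) sy; first exact: colon_ideal.
move=> a sa /=; have -> : h t * \prod_t' h t' ^+ a t' =
    \prod_t' h t' ^+ (a t' + (t' == t))%N.
  rewrite (bigD1 t) //= [RHS](bigD1 t) //= eqxx addn1 exprS mulrA; congr (_ * _).
  by apply: eq_bigr => t' /negbTE ->; rewrite addn0.
apply: Sh; rewrite big_split sa /= (bigD1 t) //= eqxx big1 => [|t' /negbTE -> //].
by rewrite addn0 addn1.
Qed.

Lemma ipow_mono (T : finType) (h : T -> A) (a : T -> nat) s :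
  (s <= \sum_t a t)%N -> ipow (idl h) s (\prod_t h t ^+ a t).
Proof.
move=> sa; apply: (@ipow_le _ _ (\sum_t a t)%N) => //; rewrite {s sa}.
have: forall r : seq T, ipow (idl h) (\sum_(t <- r) a t) (\prod_(t <- r) h t ^+ a t).
  elim=> [|t r IHr]; first by rewrite !big_nil.
  by rewrite !big_cons; apply: ipowD => //; apply/ipowX/idl_gen.
exact.
Qed.

Definition exps (T : finType) s := {a : {ffun T -> 'I_s.+1} | (\sum_t a t)%N == s}.

Definition mons (T : finType) (h : T -> A) s (a : exps T s) : A :=
  \prod_t h t ^+ val a t.

Lemma ipow_idl (T : finType) (h : T -> A) s : ipow (idl h) s = idl (@mons T h s).
Proof.
rewrite eqEsubset; split.
- apply: ipow_gen_min => [|a sa]; first exact: idl_ideal.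
  have le t : (a t < s.+1)%N by rewrite ltnS -sa (bigD1 t) //= leq_addr.
  pose b := [ffun t => Ordinal (le t)].
  have sb : (\sum_t b t)%N == s.
    by rewrite -[X in _ == X]sa; apply/eqP/eq_bigr => t _; rewrite ffunE.
  have -> : \prod_t h t ^+ a t = mons h (exist _ b sb).
    by apply: eq_bigr => t _; rewrite /= ffunE.
  exact: idl_gen.
- apply: idl_min; first exact: ipow_ideal.
  by move=> [a sa]; apply: ipow_mono; rewrite /= (eqP sa).
Qed.

Lemma idl_mul (T T' : finType) (h : T -> A) (h' : T' -> A) :
  ideal_mul (idl h) (idl h') = idl (fun t : T * T' => h t.1 * h' t.2).
Proof.
rewrite eqEsubset; split.
- apply: ideal_mul_min; first exact: idl_ideal.
  move=> _ _ [c ->] [d ->]; rewrite big_distrlr /= pair_big /=.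
  exists (fun t => c t.1 * d t.2); apply: eq_bigr => -[t t'] _ /=.
  by rewrite mulrACA.
- apply: idl_min; first exact/ideal_mul_ideal/idl_ideal.
  by move=> [t t']; apply: ideal_mulI; exact: idl_gen.
Qed.

End Ideals.

Section Codimension.
Variables (K : fieldType) (V : lmodType K).
Implicit Types I : set V.

Definition subspace I : Prop := I 0 /\ forall a u v, I u -> I v -> I (a *: u + v).

Definition spans I (T : finType) (e : T -> V) : Prop :=
  forall v, exists c : T -> K, I (v - \sum_t c t *: e t).

Definition indep I (T : finType) (e : T -> V) : Prop :=
  forall c : T -> K, I (\sum_t c t *: e t) -> forall t, c t = 0.

Lemma subspace_sum I (T : finType) (c : T -> K) (F : T -> V) :
  subspace I -> (forall t, I (F t)) -> I (\sum_t c t *: F t).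
Proof. by case=> I0 IL IF; elim/big_rec: _ => // t v _; apply: IL. Qed.

Lemma subspaceD I u v : subspace I -> I u -> I v -> I (u + v).
Proof. by case=> _ IL Iu; rewrite -[u]scale1r; exact: IL. Qed.

Lemma subspaceZ I a u : subspace I -> I u -> I (a *: u).
Proof. by case=> I0 IL Iu; rewrite -[_ *: _]addr0; exact: IL. Qed.

Lemma subspaceB I u v : subspace I -> I u -> I v -> I (u - v).
Proof. by case=> _ IL Iu Iv; rewrite addrC -scaleN1r; exact: IL. Qed.

(* Coordinates of e in terms of e' form a matrix; a vector in its left kernel
   would be a dependency. *)
Lemma indep_spans_leq I (T T' : finType) (e : T -> V) (e' : T' -> V) :
  subspace I -> indep I e -> spans I e' -> (#|T| <= #|T'|)%N.
Proof.
move=> sI ie se.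
have /choice[P HP] t : exists c : T' -> K, I (e t - \sum_t' c t' *: e' t') := se (e t).
pose M := \matrix_(i < #|T|, j < #|T'|) P (enum_val i) (enum_val j).
suff: row_free M by move=> /eqP <-; exact: rank_leq_col.
apply: inj_row_free => v vM; apply/rowP => i; rewrite mxE -[i]enum_valK.
apply: (ie (fun t => v 0 (enum_rank t))).
have -> : \sum_t v 0 (enum_rank t) *: e t =
    \sum_t v 0 (enum_rank t) *: (e t - \sum_t' P t t' *: e' t').
  apply/eqP; rewrite -subr_eq0 -sumrB; apply/eqP.
  under eq_bigr do rewrite -scalerBr opprB addrC subrK scaler_sumr.
  rewrite exchange_big big1 //= => t' _.
  under eq_bigr do rewrite scalerA.
  rewrite -scaler_suml (_ : \sum_t _ = 0) ?scale0r //.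
  have := congr1 (fun w : 'rV_#|T'| => w 0 (enum_rank t')) vM.
  rewrite !mxE => vM0; rewrite -[RHS]vM0.
  rewrite (reindex_onto enum_val enum_rank) /= => [|t _]; last exact: enum_rankK.
  by apply: eq_big => j; rewrite ?enum_valK ?eqxx // mxE enum_rankK.
exact: subspace_sum.
Qed.

(** The two halves of a basis are separated because they play opposite parts: spanning bounds a
    colength from above, independence from below. *)
Lemma quot_basisP I d (e : 'I_d -> V) : subspace I ->
  quot_basis I e <-> spans I e /\ indep I e.
Proof.
move=> sI; split=> [B|[se ie] v].
- split=> [v|c Ic t]; first by case: (B v) => c [Ic _]; exists (c 0).
  have [c0 [_ c0u]] := B 0.
  have E (b : 'I_d -> K) : I (\sum_t b t *: e t) -> c0 = \row_t b t.
    move=> Ib; apply: c0u; rewrite sub0r -scaleN1r; apply: (subspaceZ _ sI).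
    by under eq_bigr do rewrite mxE.
  have: \row_t c t = \row_t (0 : K).
    rewrite -(E c) // -(E (fun=> 0)) // big1 => [|t' _]; last by rewrite scale0r.
    by case: sI.
  by move=> /rowP/(_ t); rewrite !mxE.
- have [c Ic] := se v; exists (\row_t c t); split=> [|c' Ic'].
    by under eq_bigr do rewrite mxE.
  apply/rowP => t; rewrite mxE; apply/eqP; rewrite -subr_eq0; apply/eqP.
  apply: (ie (fun t => c t - c' 0 t)).
  under eq_bigr do rewrite scalerBl.
  rewrite sumrB (_ : _ - _ = (v - \sum_t c' 0 t *: e t) - (v - \sum_t c t *: e t)).
    exact: subspaceB.
  by rewrite opprB [RHS]addrC addrA subrK.
Qed.

(** A spanning family of least size is independent, since a member with a nonzero coefficient in a
    dependency could be dropped. *)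
Lemma spans_basis I (T : finType) (e : T -> V) : subspace I -> spans I e ->
  exists d (e' : 'I_d -> V), quot_basis I e'.
Proof.
move=> sI se; pose P d := `[< exists e' : 'I_d -> V, spans I e' >].
have exP : exists d, P d.
  exists #|T|; apply/asboolP; exists (e \o enum_val) => v.
  have [c Ic] := se v; exists (c \o enum_val); move: Ic.
  rewrite (reindex_onto (@enum_val T T) enum_rank) /= => [|t _]; last exact: enum_rankK.
  by under eq_bigl do rewrite enum_valK eqxx.
case: (ex_minnP exP) => d /asboolP[e' se'] dmin; exists d, e'; apply/quot_basisP => //.
split=> // c Ic t; apply: contrapT => /eqP ct.
case: d e' se' dmin c Ic t ct => [|d] e' se' dmin c Ic t ct; first by case: t ct.
suff: P d by move=> /dmin; rewrite ltnn.
apply/asboolP; exists (e' \o lift t) => v; have [b Ib] := se' v.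
(* Subtracting [b t / c t] times the dependency clears the coordinate at [t]. *)
exists (fun j => b (lift t j) - b t / c t * c (lift t j)).
have := subspaceD sI Ib (subspaceZ (b t / c t) sI Ic).
have E (F : 'I_d.+1 -> V) : \sum_i F i = F t + \sum_j F (lift t j) by exact: bigD1_ord.
rewrite 2!E scalerDr scalerA divfK //.
under [in X in _ -> X]eq_bigr do rewrite scalerBl -scalerA.
by rewrite sumrB -scaler_sumr opprD opprB -!addrA (addrCA (- \sum_j _)) addKr [- _ + _]addrC.
Qed.

End Codimension.

(** * Power series *)

Section Series.
Variables (n : nat) (K : comNzRingType).
Local Notation R := (mfps n K).
Local Notation cf := (@mfps_coef n K).
Implicit Types (f g : R) (m b : multinom n).

Lemma mfps_coef0 m : cf 0 m = 0. Proof. by []. Qed.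
Lemma mfps_coefD f g m : cf (f + g) m = cf f m + cf g m. Proof. by []. Qed.
Lemma mfps_coefB f g m : cf (f - g) m = cf f m - cf g m. Proof. by []. Qed.
Lemma mfps_coefZ c f m : cf (c *: f) m = c * cf f m. Proof. by []. Qed.
Lemma mfps_coef1 m : cf 1 m = (m == mnm0)%:R. Proof. by []. Qed.

Lemma mfps_coef_sum (T : Type) (r : seq T) (P : pred T) (F : T -> R) m :
  cf (\sum_(t <- r | P t) F t) m = \sum_(t <- r | P t) cf (F t) m.
Proof. by rewrite -[LHS]/((fun f => cf f m) _); apply: big_morph. Qed.

Definition order_ge s : set R := [set f | forall m, (mdeg m < s)%N -> cf f m = 0].

Definition monomial b : R := MFPS (fun m => (m == b)%:R).

Lemma mdeg_lem m b : mpoly.lem b m -> (mdeg b <= mdeg m)%N.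
Proof. by move=> bm; rewrite -(submK bm) mdegD leq_addl. Qed.

Lemma coef_monomialM b f m :
  cf (monomial b * f) m = if mpoly.lem b m then cf f (mnm_sub m b) else 0.
Proof.
rewrite [LHS]/= big_mkcond /=; case: ifP => bm.
- have b1 : (mdeg b < (mdeg m).+1)%N by rewrite ltnS mdeg_lem.
  have b2 : (mdeg (mnm_sub m b) < (mdeg m).+1)%N by rewrite ltnS mdegB.
  rewrite (bigD1 (BMultinom b1, BMultinom b2)) //= big1 => [|[[k1 k1m] [k2 k2m]]] /=.
    by rewrite addmC submK // eqxx eqxx mul1r addr0.
  rewrite xpair_eqE !bmeqP /=; case: (m =P _) => // ->.
  have [->|] := eqVneq k1 b; last by rewrite mul0r.
  by rewrite addmC addmK eqxx.
- apply: big1 => -[[k1 k1m] [k2 k2m]] _ /=; case: (m =P _) => // mE.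
  have [k1b|] := eqVneq k1 b; last by rewrite mul0r.
  by move: bm; rewrite mE k1b lem_addr.
Qed.

Lemma order_geM s t f g : order_ge s f -> order_ge t g -> order_ge (s + t) (f * g).
Proof.
move=> fs gt m md /=; apply: big1 => -[[k1 k1m] [k2 k2m]] /= /eqP mE.
move: md; rewrite mE mdegD => md; have [k1s|sk1] := ltnP (mdeg k1) s.
  by rewrite fs ?mul0r.
by rewrite gt ?mulr0 //; rewrite -(ltn_add2l s); apply: leq_ltn_trans md; rewrite leq_add2r.
Qed.

Lemma order_ge_ideal s : is_ideal (order_ge s).
Proof.
split=> [m _ //|f g fs gs m md|c f fs]; first by rewrite mfps_coefD fs // gs // addr0.
by rewrite -[s]add0n; apply: order_geM.
Qed.

Lemma order_ge_le s t : (s <= t)%N -> order_ge t `<=` order_ge s.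
Proof. by move=> st f ft m ms; apply: ft; apply: leq_trans st. Qed.

Lemma order_geX s e : order_ge 1 e -> order_ge s (e ^+ s).
Proof.
move=> e1; elim: s => [|s IHs]; first by move=> m.
by rewrite exprS -add1n; apply: order_geM.
Qed.

Lemma order_ge1E f : order_ge 1 f <-> cf f mnm0 = 0.
Proof.
split=> [f1|f0 m]; first by apply: f1; rewrite mdeg0.
by rewrite ltnS leqn0 mdeg_eq0 => /eqP ->.
Qed.

Definition const_coef f := cf f mnm0.

Fact const_coef_is_zmod_morphism : zmod_morphism const_coef.
Proof. by []. Qed.

Fact const_coef_is_monoid_morphism : monoid_morphism const_coef.
Proof.
split=> [|f g]; first by rewrite /const_coef mfps_coef1 eqxx.
have D h : order_ge 1 (h - const_coef h *: 1).
  by apply/order_ge1E; rewrite mfps_coefB mfps_coefZ mfps_coef1 eqxx mulr1 subrr.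
have -> : f * g = (f - const_coef f *: 1) * g
    + const_coef f *: (g - const_coef g *: 1) + (const_coef f * const_coef g) *: 1.
  by rewrite mulrBl -scalerAl mul1r scalerBr addrA subrK scalerA subrK.
have /order_ge1E E : order_ge 1 ((f - const_coef f *: 1) * g).
  by rewrite mulrC; have [_ _] := order_ge_ideal 1; apply; exact: D.
rewrite /const_coef !mfps_coefD E add0r !mfps_coefZ mfps_coef1 eqxx !mulr1.
by rewrite mfps_coefB mfps_coefZ mfps_coef1 eqxx mulr1 subrr mulr0 add0r.
Qed.

HB.instance Definition _ := GRing.isZmodMorphism.Build R K const_coef
  const_coef_is_zmod_morphism.
HB.instance Definition _ := GRing.isMonoidMorphism.Build R K const_coef
  const_coef_is_monoid_morphism.

(** Geometric series in [e = 1 - f]: as e has no constant term, the coefficient at m is already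
    final in the partial sum of the powers up to [mdeg m]. *)
Lemma series_unit f : const_coef f = 1 -> f \is a GRing.unit.
Proof.
move=> f1; pose e := 1 - f.
have e1 : order_ge 1 e.
  by apply/order_ge1E; rewrite -/(const_coef e) rmorphB rmorph1 /= f1 subrr.
pose S d := \sum_(k < d) e ^+ k.
have Se d m : (mdeg m < d)%N -> cf (S d) m = cf (S (mdeg m).+1) m.
  move=> md; rewrite /S !mfps_coef_sum [RHS](big_ord_widen d (fun k => cf (e ^+ k) m)) //.
  rewrite [RHS]big_mkcond; apply: eq_bigr => k _; case: ltnP => // mk.
  exact: (order_geX e1).
pose g := MFPS (fun m => cf (S (mdeg m).+1) m).
suff gf : g * f = 1 by apply/unitrP; exists g; rewrite [f * g]mulrC.
apply: mfpsP => m; pose d := (mdeg m).+1; apply/eqP; rewrite -subr_eq0 -mfps_coefB; apply/eqP.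
suff: order_ge d (g * f - 1) by apply; rewrite ltnSn.
have fS : f * S d = 1 - e ^+ d.
  by rewrite -opprB subrX1 -mulNr opprB /e subKr.
have -> : g * f - 1 = f * (g - S d) - e ^+ d.
  by rewrite mulrBr fS; ring.
apply: (idealB (order_ge_ideal d)); last exact: order_geX.
have [_ _] := order_ge_ideal d; apply=> m' md.
by rewrite mfps_coefB Se // subrr.
Qed.

Lemma order_geS s f : order_ge s.+1 f ->
  exists c : 'I_n -> R, (forall i, order_ge s (c i)) /\ f = \sum_i mfps_X K i * c i.
Proof.
(* For each nonzero exponent one variable dividing it is selected, so every monomial of f is charged
   to exactly one [c i]. *)
move=> fs; pose sel m := [pick i | 0 < m i]%N.
exists (fun i => MFPS (fun m =>
  if sel (mnm_add m (mnm1 i)) == Some i then cf f (mnm_add m (mnm1 i)) else 0)).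
split=> [i m ms /=|].
  by case: ifP => // _; apply: fs; rewrite mdegD mdeg1 addn1.
apply: mfpsP => m; rewrite mfps_coef_sum.
have E i : mpoly.lem (mnm1 i) m = (0 < m i)%N.
  apply/mnm_lepP/idP => [/(_ i)|mi j]; first by rewrite mnm1E eqxx.
  by rewrite mnm1E; case: eqP => [<-|].
rewrite (eq_bigr (fun i => if sel m == Some i then cf f m else 0)) => [|i _]; last first.
  rewrite (coef_monomialM (mnm1 i)) E /=; have [mi|mi] := ltnP 0 (m i).
    by rewrite submK ?E.
  case: eqP => // /esym; rewrite /sel; case: pickP => // j mj [ij].
  by move: mi; rewrite ij leqNgt mj.
rewrite /sel; case: pickP => [i mi|m0].
  rewrite (bigD1 i) //= eqxx big1 ?addr0 // => j ji.
  by case: ifP => // /eqP[ij]; rewrite ij eqxx in ji.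
rewrite big1 //; apply: fs; suff -> : m = mnm0 by rewrite mdeg0.
by apply/mnmP => i; rewrite mnm0E; apply/eqP; rewrite -leqn0 leqNgt m0.
Qed.

Lemma order_ge_ipow s : order_ge s = ipow (idl (@mfps_X n K)) s.
Proof.
rewrite eqEsubset; split.
- elim: s => [|s IHs] // f /order_geS[c [cs ->]].
  apply: ideal_sum => [|i _]; first exact: (ipow_ideal _ s.+1).
  by apply: ideal_mulI; [exact: idl_gen|exact: IHs].
- elim: s => [|s IHs]; first by move=> f _ m.
  apply: ideal_mul_min; first exact: order_ge_ideal.
  move=> f g f1 /IHs gs; rewrite -add1n; apply: order_geM => //.
  move: f1; apply: idl_min; first exact: order_ge_ideal.
  move=> i; apply/order_ge1E; rewrite /= eq_sym.
  by case: eqP => // /(congr1 (@mdeg n)); rewrite mdeg1 mdeg0.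
Qed.

Definition agree d f (p : mpoly n K) :=
  forall m, (mdeg m < d)%N -> cf f m = mcoeff m p.

Lemma agreeM d f g p q : agree d f p -> agree d g q -> agree d (f * g) (p * q).
Proof.
move=> fp gq m md; rewrite mcoeffM /=; apply: eq_bigr => -[[k1 k1m] [k2 k2m]] _ /=.
by rewrite fp ?gq //; [exact: leq_trans k2m md | exact: leq_trans k1m md].
Qed.

Definition trunc_mpoly d f : mpoly n K :=
  \sum_(m : bmultinom n d) cf f m *: mpolyX K m.

Lemma agree_trunc d f : agree d f (trunc_mpoly d f).
Proof. by move=> m md; rewrite mcoeff_mpoly. Qed.

Lemma agree_deriv d i f p : agree d.+1 f p ->
  agree d (mfps_deriv i f) (mderiv i p).
Proof.
by move=> fp m md; rewrite mcoeff_deriv /= fp // mdegD mdeg1 addn1.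
Qed.

Lemma derivM i f g :
  mfps_deriv i (f * g) = mfps_deriv i f * g + f * mfps_deriv i g.
Proof.
(* Differentiation lowers degrees by one, so the coefficient at [m] requires agreement up to degree
   [(mdeg m).+1]. *)
apply: mfpsP => m; have T := @agree_trunc (mdeg m).+2.
have W d h p : agree d.+1 h p -> agree d h p by move=> E m' md; apply/E/ltnW.
rewrite (agree_deriv i (agreeM (T f) (T g))) // mderivM mcoeffD mfps_coefD.
rewrite !(agreeM (agree_deriv i (T _)) (W _ _ _ (T _))) //.
by rewrite (agreeM (W _ _ _ (T _)) (agree_deriv i (T _))).
Qed.

(** Determinant trick: modulo N the vector of generators is killed by a matrix 1 - a with the
    entries of a in m, and det (1 - a) has constant coefficient 1, hence is a unit. *)
Lemma nakayama (T : finType) (h : T -> R) (N : set R) : is_ideal N ->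
  idl h `<=` ideal_add N (ideal_mul (order_ge 1) (idl h)) -> idl h `<=` N.
Proof.
move=> iN hN; apply: idl_min => //.
pose k := #|T|; pose v (i : 'I_k) := h (enum_val i).
have /choice[a Pa] (i : 'I_k) : exists a : 'I_k -> R,
    (forall j, order_ge 1 (a j)) /\ N (v i - \sum_j a j * v j).
  have /hN[x Nx [y my xy]] := idl_gen h (enum_val i).
  suff: ideal_mul (order_ge 1) (idl h) `<=` [set y | exists a : 'I_k -> R,
      (forall j, order_ge 1 (a j)) /\ y = \sum_j a j * v j].
    by move=> /(_ _ my)[a [a1 yE]]; exists a; rewrite -yE /v -xy addrK.
  move=> _ [s [sP ->]]; rewrite big_seq.
  apply: (big_ind (fun y => exists a : 'I_k -> R,
      (forall j, order_ge 1 (a j)) /\ y = \sum_j a j * v j)).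
  - exists (fun=> 0); split=> [j|]; first by have [] := order_ge_ideal 1.
    by rewrite big1 // => j _; rewrite mul0r.
  - move=> _ _ [a [a1 ->]] [b [b1 ->]]; exists (fun j => a j + b j); split.
      by move=> j; have [_ + _] := order_ge_ideal 1; apply.
    by rewrite -big_split; apply: eq_bigr => j _; rewrite mulrDl.
  - move=> p /sP[p1 [c ->]]; exists (fun j => p.1 * c (enum_val j)); split.
      by move=> j; rewrite mulrC; have [_ _] := order_ge_ideal 1; apply.
    rewrite mulr_sumr (reindex_onto (@enum_val T T) enum_rank) /= => [|t _]; last first.
      exact: enum_rankK.
    by apply: eq_big => [j|j _]; rewrite ?enum_valK ?eqxx // mulrA.
pose B := \matrix_(i, j) ((i == j)%:R - a i j).
have Bv i : N (\sum_j B i j * v j).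
  rewrite (_ : \sum_j _ = v i - \sum_j a i j * v j); first by case: (Pa i).
  under eq_bigr do rewrite mxE mulrBl.
  rewrite sumrB (bigD1 i) //= eqxx mul1r [X in _ + X - _]big1 ?addr0 // => j ji.
  by rewrite eq_sym (negbTE ji) mul0r.
have uB : \det B \is a GRing.unit.
  apply: series_unit; rewrite -det_map_mx (_ : map_mx _ B = 1%:M) ?det1 //.
  apply/matrixP => i j; rewrite !mxE rmorphB rmorph_nat.
  have /order_ge1E E : order_ge 1 (a i j) by case: (Pa i).
  by rewrite -[RHS]subr0; congr (_ - _); exact: E.
move=> t; rewrite -[t]enum_rankK -/(v _) -[v _](mulKr uB).
have [_ _] := iN; apply; move: (enum_rank t) => i.
have -> : \det B * v i = \sum_j \adj B i j * \sum_l B j l * v l.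
  under eq_bigr do rewrite mulr_sumr.
  rewrite exchange_big /= (eq_bigr (fun l => (\adj B *m B) i l * v l)) => [|l _].
    rewrite mul_adj_mx (bigD1 i) //= mxE eqxx big1 ?addr0 // => l li.
    by rewrite mxE eq_sym (negbTE li) mul0r.
  by rewrite mxE mulr_suml; apply: eq_bigr => j _; rewrite mulrA.
apply: ideal_sum => // j _; have [_ _] := iN; apply; exact: Bv.
Qed.

Lemma ideal_subspace (I : set (mfps n K)) a u v :
  is_ideal I -> I u -> I v -> I (a *: u + v).
Proof.
case=> _ ID IM Iu Iv; apply: ID => //; rewrite -[u]mul1r scalerAl; exact: IM.
Qed.

End Series.

Section MapSeries.
Variables (n : nat) (A B : comNzRingType) (phi : {rmorphism A -> B}).

Definition map_mfps (f : mfps n A) : mfps n B := MFPS (fun m => phi (mfps_coef f m)).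

Fact map_mfps_is_zmod_morphism : zmod_morphism map_mfps.
Proof. by move=> f g; apply: mfpsP => m; rewrite /= rmorphB. Qed.

Fact map_mfps_is_monoid_morphism : monoid_morphism map_mfps.
Proof.
split=> [|f g]; apply: mfpsP => m; rewrite /= ?rmorph_nat // rmorph_sum.
by apply: eq_bigr => k _; rewrite rmorphM.
Qed.

HB.instance Definition _ := GRing.isZmodMorphism.Build _ _ map_mfps
  map_mfps_is_zmod_morphism.
HB.instance Definition _ := GRing.isMonoidMorphism.Build _ _ map_mfps
  map_mfps_is_monoid_morphism.

Lemma map_mfpsZ c f : map_mfps (c *: f) = phi c *: map_mfps f.
Proof. by apply: mfpsP => m; rewrite /= rmorphM. Qed.

Lemma map_monomial b : map_mfps (monomial A b) = monomial B b.
Proof. by apply: mfpsP => m; rewrite /= rmorph_nat. Qed.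

End MapSeries.

(** * Frobenius *)

Section Truncation.
Variables (n : nat) (K : comNzRingType).
Local Notation R := (mfps n K).
Local Notation cf := (@mfps_coef n K).
Implicit Types (f : R) (a b m : multinom n).

Lemma monomialM a b : monomial K a * monomial K b = monomial K (mnm_add a b).
Proof.
apply: mfpsP => m; rewrite coef_monomialM /=; case: ifP => am.
  by rewrite -{2}(submK am) [mnm_add _ a]addmC eqm_add2l.
by case: eqP => // mE; move: am; rewrite mE lem_addr.
Qed.

Lemma monomialX b k : monomial K b ^+ k = monomial K (mnm_muln b k).
Proof.
elim: k => [|k IHk]; first by rewrite mulm0n.
by rewrite exprS IHk monomialM mulmS.
Qed.

Lemma monomial_order b : order_ge (mdeg b) (monomial K b).
Proof. by move=> m mb /=; case: eqP mb => // ->; rewrite ltnn. Qed.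

Definition trunc d f : R := \sum_(b : bmultinom n d) cf f b *: monomial K b.

Lemma coef_trunc d f m : cf (trunc d f) m = if (mdeg m < d)%N then cf f m else 0.
Proof.
rewrite mfps_coef_sum; case: ifP => md.
  rewrite (bigD1 (BMultinom md)) //= eqxx mulr1 big1 ?addr0 // => b.
  by rewrite bmeqP eq_sym /= => /negbTE ->; rewrite mulr0.
rewrite big1 // => -[b bd] _ /=; case: eqP => [mb|]; last by rewrite mulr0.
by rewrite mb bd in md.
Qed.

Lemma trunc_order d f : order_ge d (f - trunc d f).
Proof. by move=> m md; rewrite mfps_coefB coef_trunc md subrr. Qed.

End Truncation.

Lemma frobenius_sum (A : comNzRingType) q (T : finType) (F : T -> A) :
  [pchar A].-nat q -> (\sum_t F t) ^+ q = \sum_t F t ^+ q.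
Proof.
move=> qA; apply: (big_morph (fun x => x ^+ q)) => [x y|]; first exact: exprDn_pchar.
by rewrite expr0n; case: q qA.
Qed.

Lemma frobenius_sub (A : comNzRingType) q (x y : A) :
  [pchar A].-nat q -> (x - y) ^+ q = x ^+ q - y ^+ q.
Proof. by move=> qA; rewrite exprDn_pchar // exprNn_pchar. Qed.

Section Frobenius.
Variables (n : nat) (K : fieldType) (p : nat).
Hypothesis pK : p \in [pchar K].
Hypothesis perfect : forall x : K, exists y, y ^+ p = x.
Variable e : nat.
Let q := (p ^ e)%N.
Local Notation R := (mfps n K).
Local Notation cf := (@mfps_coef n K).

Let p_prime : prime p. Proof. by case/andP: pK. Qed.

Let q_gt0 : (0 < q)%N. Proof. by rewrite expn_gt0 prime_gt0. Qed.

Let qK : [pchar K].-nat q.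
Proof. by rewrite pnatX orbC; case: e => // e'; rewrite pnatE ?pK. Qed.

Let pR : p \in [pchar R].
Proof.
rewrite inE p_prime; case/andP: pK => _ /eqP p0.
by rewrite -[p%:R]scaler_nat p0 scale0r eqxx.
Qed.

Let qR : [pchar R].-nat q.
Proof. by rewrite pnatX orbC; case: e => // e'; rewrite pnatE ?pR. Qed.

Lemma frobenius_inj (x y : K) : x ^+ q = y ^+ q -> x = y.
Proof.
move=> /eqP; rewrite -subr_eq0 -frobenius_sub // expf_eq0 q_gt0 /= subr_eq0.
by move/eqP.
Qed.

Lemma frobenius_root : exists r : K -> K, forall x, r x ^+ q = x.
Proof.
suff H x : exists y : K, y ^+ q = x by have [r ?] := choice H; exists r.
rewrite /q; elim: e x => [|k IHk] x; first by exists x.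
have [y <-] := perfect x; have [z <-] := IHk y.
by exists z; rewrite expnSr exprM.
Qed.

(** Componentwise division of exponents by q: the remainder [digits] names a basis monomial, the
    quotient [carry] an exponent of the series raised to the q-th power. *)
Definition digits (m : multinom n) : {ffun 'I_n -> 'I_q} :=
  [ffun i => Ordinal (ltn_pmod (m i) q_gt0)].

Definition carry (m : multinom n) : multinom n := Multinom [tuple (m i %/ q)%N | i < n].

Definition of_digits (b : {ffun 'I_n -> 'I_q}) : multinom n :=
  Multinom [tuple (b i : nat) | i < n].

Definition splice (b : {ffun 'I_n -> 'I_q}) (m : multinom n) : multinom n :=
  Multinom [tuple (m i * q + b i)%N | i < n].

Lemma digits_splice b m : digits (splice b m) = b.
Proof. by apply/ffunP => i; apply/val_inj; rewrite ffunE /= mnmE modnMDl modn_small. Qed.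

Lemma carry_splice b m : carry (splice b m) = m.
Proof. by apply/mnmP => i; rewrite !mnmE divnMDl // divn_small ?addn0. Qed.

Lemma splice_digits m : splice (digits m) (carry m) = m.
Proof. by apply/mnmP => i; rewrite !mnmE ffunE /= -divn_eq. Qed.

Lemma coef_frobenius (w : R) b m :
  cf (monomial K (of_digits b) * w ^+ q) m = if digits m == b then cf w (carry m) ^+ q else 0.
Proof.
pose d := (mdeg m).+1; pose B := monomial K (of_digits b).
(* Frobenius is additive on finite sums, so w is first truncated; the error has order at least d,
   and so has its q-th power. *)
have -> : cf (B * w ^+ q) m = cf (B * trunc d w ^+ q) m.
  apply/eqP; rewrite -subr_eq0 -mfps_coefB -mulrBr -frobenius_sub //; apply/eqP.
  suff: order_ge d (B * (w - trunc d w) ^+ q) by apply.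
  have [_ _] := order_ge_ideal n K d; apply; rewrite -(prednK q_gt0) exprSr.
  have [_ _] := order_ge_ideal n K d; apply; exact: trunc_order.
rewrite frobenius_sum // mulr_sumr mfps_coef_sum.
have E (c : bmultinom n d) :
    cf (B * (cf w c *: monomial K c) ^+ q) m = cf w c ^+ q * (m == splice b c)%:R.
  rewrite exprZn monomialX -scalerAr mfps_coefZ monomialM /=; congr (_ * (m == _)%:R).
  by apply/mnmP => i; rewrite !mnmE mulmnE addnC.
rewrite (eq_bigr _ (fun c _ => E c)); case: eqP => [mb|mb].
  have cd : (mdeg (carry m) < d)%N.
    by rewrite ltnS !mdegE; apply: leq_sum => i _; rewrite mnmE leq_div.
  rewrite (bigD1 (BMultinom cd)) //= -mb splice_digits eqxx mulr1 big1 ?addr0 // => c.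
  rewrite bmeqP /= => cm; case: eqP => [mE|]; last by rewrite mulr0.
  by move: cm; rewrite mE carry_splice eqxx.
rewrite big1 // => c _; case: eqP => [mE|]; last by rewrite mulr0.
by case: mb; rewrite mE digits_splice.
Qed.

Lemma coef_frobenius_sum (w : {ffun 'I_n -> 'I_q} -> R) b m :
  cf (\sum_b monomial K (of_digits b) * w b ^+ q) (splice b m) = cf (w b) m ^+ q.
Proof.
rewrite mfps_coef_sum (bigD1 b) // coef_frobenius digits_splice carry_splice eqxx.
rewrite big1 => [|b' b'b]; first exact: addr0.
by rewrite coef_frobenius digits_splice eq_sym (negbTE b'b).
Qed.

(* As K is perfect, R is free over its subring of q-th powers, on the monomials
   with exponents below q. *)
Lemma frobenius_decomp (w : R) : exists w' : {ffun 'I_n -> 'I_q} -> R,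
  w = \sum_b monomial K (of_digits b) * w' b ^+ q.
Proof.
have [r rq] := frobenius_root.
exists (fun b => MFPS (fun m => r (cf w (splice b m)))); apply: mfpsP => m.
by rewrite -[m in RHS]splice_digits coef_frobenius_sum /= rq splice_digits.
Qed.

Lemma frobenius_decomp_inj (w w' : {ffun 'I_n -> 'I_q} -> R) :
  \sum_b monomial K (of_digits b) * w b ^+ q =
    \sum_b monomial K (of_digits b) * w' b ^+ q -> w =1 w'.
Proof.
move=> E b; apply: mfpsP => m; apply: frobenius_inj.
by rewrite -coef_frobenius_sum E coef_frobenius_sum.
Qed.

Definition frobenius_basis (T : finType) (h : T -> R)
    (t : {ffun 'I_n -> 'I_q} * T) : R :=
  monomial K (of_digits t.1) * h t.2 ^+ q.

Lemma frobenius_spans (S T : finType) (h : S -> R) (u : T -> R) :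
  spans (idl h) u -> spans (idl (fun s => h s ^+ q)) (frobenius_basis u).
Proof.
move=> su v; have [w ->] := frobenius_decomp v.
have /choice[c Hc] b := su (w b).
exists (fun t => c t.1 t.2 ^+ q).
rewrite -(pair_bigA _ (fun b t => c b t ^+ q *: frobenius_basis u (b, t))) /=.
rewrite -sumrB; apply: ideal_sum => [|b _]; first exact: idl_ideal.
rewrite /frobenius_basis /=; under [X in _ - X]eq_bigr do rewrite scalerAr -exprZn.
rewrite -mulr_sumr -mulrBr -frobenius_sum // -frobenius_sub //.
have [_ _] := idl_ideal (fun s => h s ^+ q); apply.
have [d ->] := Hc b; rewrite frobenius_sum //; exists (fun s => d s ^+ q).
by apply: eq_bigr => s _; rewrite exprMn.
Qed.

(** The multipliers of the [h s ^+ q] are decomposed along the x^b. Uniqueness of the decomposition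
    allows comparison for each b, and extracting q-th roots leaves a dependency of u modulo
    [idl h]. *)
Lemma frobenius_indep (S T : finType) (h : S -> R) (u : T -> R) :
  indep (idl h) u -> indep (idl (fun s => h s ^+ q)) (frobenius_basis u).
Proof.
move=> iu c [d E]; have [r rq] := frobenius_root.
have /choice[w Hw] s := frobenius_decomp (d s).
have {}E : \sum_b monomial K (of_digits b) * (\sum_t r (c (b, t)) *: u t) ^+ q =
    \sum_b monomial K (of_digits b) * (\sum_s w s b * h s) ^+ q.
  transitivity (\sum_t c t *: frobenius_basis u t).
    rewrite [RHS](eq_bigr (fun t => c (t.1, t.2) *: frobenius_basis u (t.1, t.2))) => [|[] //].
    rewrite -[RHS](pair_bigA _ (fun b t => c (b, t) *: frobenius_basis u (b, t))) /=.
    apply: eq_bigr => b _; rewrite frobenius_sum // mulr_sumr; apply: eq_bigr => t _.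
    by rewrite exprZn rq -scalerAr.
  rewrite E (eq_bigr _ (fun s _ => congr1 (fun x => x * _) (Hw s))).
  under eq_bigr do rewrite mulr_suml.
  rewrite exchange_big; apply: eq_bigr => b _.
  rewrite frobenius_sum // mulr_sumr; apply: eq_bigr => s _.
  by rewrite exprMn mulrA.
case=> b t; have Eb := frobenius_decomp_inj E b.
have : idl h (\sum_t r (c (b, t)) *: u t) by exists (w^~ b); rewrite Eb.
by move=> /iu /(_ t) rc; rewrite -[LHS]rq rc expr0n gtn_eqF.
Qed.

End Frobenius.

(** * Colengths of Frobenius powers *)

Lemma sum_option (V : nmodType) (T : finType) (F : option T -> V) :
  \sum_i F i = F None + \sum_t F (Some t).
Proof.
rewrite (bigD1 None) //= (reindex_omap Some id) => [|[]] //=; congr (_ + _).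
by apply: eq_bigl => t; rewrite eqxx.
Qed.

Lemma spans_sub (K : fieldType) (V : lmodType K) (I : set V) (T : finType)
    (A : pred T) (e : T -> V) :
  (forall v, exists c : T -> K,
     (forall t, ~~ A t -> c t = 0) /\ I (v - \sum_t c t *: e t)) ->
  spans I (fun t : {t | A t} => e (val t)).
Proof.
move=> se v; have [c [c0 Ic]] := se v; exists (c \o val).
have cA : \sum_(t | ~~ A t) c t *: e t = 0.
  by apply: big1 => t /c0 ->; rewrite scale0r.
rewrite (bigID A) /= cA addr0 in Ic.
rewrite (reindex_omap (val : {t | A t} -> T) insub) /= in Ic => [|t At];
  last by rewrite insubT.
by rewrite (eq_bigl xpredT) // in Ic => -[t At]; rewrite /= At insubT /= eqxx.
Qed.

Definition box_count (n q t : nat) : nat :=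
  #|[pred a : {ffun 'I_n -> 'I_q} | (\sum_i a i < t)%N]|.

Section BoxSpan.
Variables (n k : nat) (K : fieldType) (q : nat) (g : 'I_k -> mfps n K).
Variables (T : finType) (E : T -> mfps n K).
Hypothesis sE : spans (idl g) E.

Definition box_fam (x : {ffun 'I_k -> 'I_q} * T) : mfps n K :=
  E x.2 * \prod_i g i ^+ (x.1 i).

Let gq := idl (fun i => g i ^+ q).
Let Sp s := [set z : mfps n K | exists c : {ffun 'I_k -> 'I_q} * T -> K,
  (forall x : {ffun 'I_k -> 'I_q} * T, (\sum_i x.1 i < s)%N -> c x = 0) /\
  gq (z - \sum_x c x *: box_fam x)].

Let gqi : is_ideal gq. Proof. exact: idl_ideal. Qed.

Let big_mono (a : 'I_k -> nat) i : (q <= a i)%N -> gq (\prod_i g i ^+ a i).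
Proof.
move=> qa; rewrite (bigD1 i) //= -(subnK qa) exprD mulrAC.
by have [_ _] := gqi; apply; exact: idl_gen.
Qed.

Let Sp_sub s : subspace (Sp s).
Proof.
split=> [|a u v [c [c0 cu]] [d [d0 dv]]].
  exists (fun=> 0); split=> //; rewrite big1 ?subr0 => [|x _]; last by rewrite scale0r.
  by case: gqi.
exists (fun x => a * c x + d x); split=> [x xs|].
  by rewrite c0 // d0 // mulr0 addr0.
under eq_bigr do rewrite scalerDl -scalerA.
rewrite big_split /= -scaler_sumr opprD addrACA -scalerBr.
exact: ideal_subspace.
Qed.

Let Sp_gq s z : gq z -> Sp s z.
Proof.
by move=> gz; exists (fun=> 0); split=> //; rewrite big1 ?subr0 // => x _; rewrite scale0r.
Qed.

Let Sp_mono (a : 'I_k -> nat) t : Sp (\sum_i a i)%N (E t * \prod_i g i ^+ a i).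
Proof.
have [lt|/existsNP[i /negP]] := pselect (forall i, (a i < q)%N); last first.
  rewrite -leqNgt => qa; apply: Sp_gq; have [_ _] := gqi; apply; exact: big_mono qa.
pose x : {ffun 'I_k -> 'I_q} * T := ([ffun i => Ordinal (lt i)], t).
exists (fun y => (y == x)%:R); split=> [y ya|].
  case: eqP ya => // ->; rewrite (eq_bigr a) ?ltnn // => i _.
  by rewrite ffunE.
have -> : \sum_y (y == x)%:R *: box_fam y = box_fam x.
  rewrite (bigD1 x) //= eqxx scale1r big1 ?addr0 // => y /negbTE ->.
  exact: scale0r.
rewrite (_ : box_fam x = E t * \prod_i g i ^+ a i) ?subrr; first by case: gqi.
by rewrite /box_fam /=; congr (_ * _); apply: eq_bigr => i _; rewrite ffunE.
Qed.

(** Descending induction on s. Expanding the coefficients of the degree s monomials along E leaves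
    an error in J^(s+1), where J is [idl g]. Once s exceeds k q, every monomial has an exponent at
    least q and vanishes modulo the g_i^q. *)
Lemma box_span s z : ipow (idl g) s z -> exists c : {ffun 'I_k -> 'I_q} * T -> K,
  (forall x : {ffun 'I_k -> 'I_q} * T, (\sum_i x.1 i < s)%N -> c x = 0) /\
  idl (fun i => g i ^+ q) (z - \sum_x c x *: box_fam x).
Proof.
rewrite -/(Sp s z); have : (k * q < (k * q).+1 - s + s)%N by lia.
move: ((k * q).+1 - s)%N => N; elim: N s z => [|N IHN] s z sN sz.
  apply: Sp_gq; move: z sz; apply: ipow_gen_min => // a sa.
  have [lt|/existsNP[i /negP]] := pselect (forall i, (a i < q)%N); last first.
    by rewrite -leqNgt; exact: big_mono.
  suff: (s <= k * q)%N by lia.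
  by rewrite -sa -[X in (X * _)%N]card_ord -sum_nat_const; apply: leq_sum => i _; exact: ltnW.
have Sle z' : Sp s.+1 z' -> Sp s z'.
  by case=> c [c0 Hc]; exists c; split=> // x xs; apply: c0; lia.
rewrite ipow_idl in sz; case: sz => r ->.
have /choice[c Hc] a := sE (r a).
rewrite (_ : \sum_a _ = \sum_a \sum_t c a t *: (E t * mons g a)
    + \sum_a (r a - \sum_t c a t *: E t) * mons g a); last first.
  rewrite -big_split; apply: eq_bigr => a _ /=; rewrite mulrBl mulr_suml addrC.
  by under eq_bigr do rewrite scalerAl; rewrite subrK.
apply: (subspaceD (Sp_sub s)).
  apply: big_ind => [|u v|a _]; first by case: (Sp_sub s).
    exact: (subspaceD (Sp_sub s)).
  apply: subspace_sum => // t; have := Sp_mono (fun i => val a i : nat) t.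
  by rewrite (eqP (valP a)).
apply/Sle/IHN; first by lia.
apply: ideal_sum => [|a _]; first exact: (ipow_ideal _ s.+1).
have Ia : ipow (idl g) s (mons g a) by rewrite ipow_idl; exact: idl_gen.
by apply: ideal_mulI => //; exact: Hc.
Qed.

End BoxSpan.

Section CharacteristicP.
Variables (n : nat) (K : fieldType) (p : nat).
Hypothesis pK : p \in [pchar K].
Hypothesis perfect : forall x : K, exists y, y ^+ p = x.
Variables (g : 'I_n -> mfps n K) (f : mfps n K).
Let h (i : option 'I_n) := oapp g f i.
Variables (T S : finType) (E : T -> mfps n K) (U : S -> mfps n K).
Hypotheses (sE : spans (idl g) E) (iE : indep (idl g) E) (sU : spans (idl h) U).
Variable d : nat.
Hypothesis fd : forall j, ipow (idl g) j (f ^+ (j + d)).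

(** The statement avoids subtraction: the two box counts differ by the number of a with t <= |a| <
    t+q-d, exactly the indices that the spanning family F omits. *)
Lemma char_p_count e t : let q := (p ^ e)%N in (d <= q)%N ->
  (#|T| * box_count n q (t + q - d) <= q ^ n * #|S| + #|T| * box_count n q t)%N.
Proof.
move=> q dq; set t' := (t + q - d)%N; have tt' : (t <= t')%N by lia.
pose W := ({ffun 'I_n -> 'I_q} * S + {ffun 'I_n -> 'I_q} * T)%type.
pose low (a : {ffun 'I_n -> 'I_q}) := (\sum_i a i < t)%N.
pose keep (a : {ffun 'I_n -> 'I_q}) := low a || (t' <= \sum_i a i)%N.
pose A (w : W) := if w is inr x then keep x.1 else true.
(* The [inl] part spans the cokernel of multiplication by f^q. The [inr] part covers its image: box
   elements of degree below t enter multiplied by f^q, those of degree at least t' as they are. *)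
pose F (w : W) := match w with
  | inl y => frobenius_basis U y
  | inr x => if low x.1 then f ^+ q * box_fam g E x else box_fam g E x end.
have sgq : subspace (idl (fun i => g i ^+ q)).
  split=> [|a u v]; first by case: (idl_ideal (fun i => g i ^+ q)).
  exact: (ideal_subspace _ (idl_ideal _)).
have sF : spans (idl (fun i => g i ^+ q)) (fun w : {w | A w} => F (val w)).
  apply: (spans_sub (e := F)) => v.
  have [c [r rE]] := frobenius_spans pK perfect e sU v.
  have [c1 [_ H1]] : exists c : {ffun 'I_n -> 'I_q} * T -> K,
    (forall x : {ffun 'I_n -> 'I_q} * T, (\sum_i x.1 i < 0)%N -> c x = 0) /\
    idl (fun i => g i ^+ q) (r None - \sum_x c x *: box_fam g E x) by exact: box_span.
  (* As f^q lies in J^(q-d) and the terms that are not low lie in J^t, their product lies in J^t'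
     and can be expanded again in degrees at least t'. *)
  have [c2 [c20 H2]] : exists c : {ffun 'I_n -> 'I_q} * T -> K,
    (forall x : {ffun 'I_n -> 'I_q} * T, (\sum_i x.1 i < t')%N -> c x = 0) /\
    idl (fun i => g i ^+ q) (f ^+ q * (\sum_(x | ~~ low x.1) c1 x *: box_fam g E x)
       - \sum_x c x *: box_fam g E x).
    apply: box_span => //; rewrite /t' (_ : (t + q - d)%N = ((q - d) + t)%N); last by lia.
    apply: ipowD; first by rewrite -{2}(subnK dq).
    apply: ideal_sum => [|x]; first exact: ipow_ideal.
    rewrite /low -leqNgt => tx; rewrite -[box_fam _ _ _]mul1r scalerAl.
    have [_ _] := ipow_ideal (idl g) t; apply; rewrite /box_fam.
    by have [_ _] := ipow_ideal (idl g) t; apply; exact: ipow_mono.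
  exists (fun w => match w with inl y => c y
     | inr x => if low x.1 then c1 x else c2 x end); split.
    move=> [y|x] //=; rewrite negb_or => /andP[/negbTE -> tx].
    by rewrite c20 // ltnNge.
  rewrite big_sumType /=.
  rewrite [X in _ - (_ + X)](_ : _ = f ^+ q * (\sum_(x | low x.1) c1 x *: box_fam g E x)
     + \sum_x c2 x *: box_fam g E x); last first.
    rewrite mulr_sumr [X in _ = X + _]big_mkcond /= -big_split /=; apply: eq_bigr => x _.
    case: ifP => lx; last by rewrite add0r.
    rewrite (c20 x) ?scale0r ?addr0 -?scalerAr //.
    by move: lx; rewrite /low; lia.
  have {}H1 : idl (fun i => g i ^+ q)
      (f ^+ q * (r None - \sum_x c1 x *: box_fam g E x)).
    by have [_ _] := idl_ideal (fun i => g i ^+ q); apply.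
  have H3 : idl (fun i => g i ^+ q) (\sum_i r (Some i) * g i ^+ q).
    by exists (fun i => r (Some i)).
  have := subspaceD sgq (subspaceD sgq H1 H2) H3.
  congr (idl _ _); rewrite [in LHS](bigID (fun x => low x.1)) /=.
  have -> : v - (\sum_y c y *: frobenius_basis U y + (f ^+ q * (\sum_(x | low x.1) c1 x *: box_fam g E x)
     + \sum_x c2 x *: box_fam g E x)) = (v - \sum_y c y *: frobenius_basis U y)
     - (f ^+ q * (\sum_(x | low x.1) c1 x *: box_fam g E x)
     + \sum_x c2 x *: box_fam g E x) by ring.
  rewrite rE sum_option /=; ring.
have := indep_spans_leq sgq (frobenius_indep pK perfect (e := e) iE) sF.
have -> : #|{: {w | A w}}| = (q ^ n * #|S| + #|[pred a | keep a]| * #|T|)%N.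
  rewrite card_sig -sum1_card big_sumType /= sum1_card card_prod card_ffun !card_ord.
  congr (_ + _)%N; rewrite -[RHS]/(#|_| * #|xpredT|)%N -!sum1_card big_distrlr /=.
  by rewrite pair_big; apply: eq_bigl => x; rewrite andbT.
rewrite card_prod card_ffun !card_ord.
have keep_le : (#|[pred a | keep a]| + box_count n q t' <= q ^ n + box_count n q t)%N.
  pose B := [pred a : {ffun 'I_n -> 'I_q} | (\sum_i a i < t')%N].
  have := cardC B; rewrite card_ffun !card_ord => <-.
  rewrite -[box_count n q t']/(#|B|) addnC -addnA leq_add2l addnC.
  have := cardUI [pred a | low a] [predC B].
  suff -> : #|[predU [pred a | low a] & [predC B]]| = #|[pred a | keep a]|.
    by rewrite /box_count => <-; exact: leq_addr.
  by apply: eq_card => a; rewrite !inE -leqNgt.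
move: (q ^ n)%N (box_count n q t') (box_count n q t) #|_| #|T| #|S| keep_le => Q c' c k' m l.
move=> /(leq_mul (leqnn m)); rewrite !mulnDr [(k' * m)%N]mulnC [(Q * m)%N]mulnC; lia.
Qed.

End CharacteristicP.

(** * Lattice points in the cube *)

Section Counting.

Lemma box_count0 q t : box_count 0 q t = (0 < t)%N.
Proof.
rewrite /box_count; case: t => [|t].
  by apply: eq_card0 => a; rewrite inE ltn0.
have -> : nat_of_bool (0 < t.+1)%N = #|{ffun 'I_0 -> 'I_q}|.
  by rewrite card_ffun !card_ord expn0.
by apply: eq_card => a; rewrite !inE big_ord0.
Qed.

Lemma box_countS n q t : box_count n.+1 q t = (\sum_(j < q) box_count n q (t - j))%N.
Proof.
rewrite /box_count -sum1_card.
pose F (x : 'I_q * {ffun 'I_n -> 'I_q}) : {ffun 'I_n.+1 -> 'I_q} :=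
  [ffun i => if unlift ord0 i is Some i' then x.2 i' else x.1].
pose G (a : {ffun 'I_n.+1 -> 'I_q}) := (a ord0, [ffun i => a (lift ord0 i)]).
rewrite (reindex F) /=; last first.
  exists G => [[j b]|a] _; rewrite /F /G; last first.
    by apply/ffunP => i; rewrite ffunE; case: unliftP => [i' ->|->]; rewrite ?ffunE.
  by congr (_, _); [rewrite ffunE unlift_none|apply/ffunP => i; rewrite !ffunE liftK].
under [RHS]eq_bigr do rewrite -sum1_card.
rewrite pair_big_dep /=; apply: eq_bigl => -[j b] /=; rewrite !inE big_ord_recl.
rewrite ffunE unlift_none ltn_subRL; congr (_ + _ < _)%N.
by apply: eq_bigr => i _; rewrite ffunE liftK.
Qed.

(* The number of points of N^n with coordinate sum below t. *)
Definition simplex_count n t : nat := if n is m.+1 then 'C(t + m, m.+1) else (0 < t)%N.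

Lemma simplex_count_rec n t :
  simplex_count n.+1 t = (simplex_count n.+1 t.-1 + simplex_count n t)%N.
Proof.
case: t => [|t] /=; first by rewrite bin_small //; case: n => //= n; rewrite bin_small.
by rewrite addSn binS; case: n => [|n] //=; rewrite ?bin0 // addSnnS.
Qed.

Lemma simplex_count_sum n q t :
  simplex_count n.+1 t = (simplex_count n.+1 (t - q) + \sum_(j < q) simplex_count n (t - j))%N.
Proof.
elim: q => [|q ->]; first by rewrite big_ord0 addn0 subn0.
by rewrite big_ord_recr [X in (X + _)%N = _]simplex_count_rec -subnS addnAC addnA.
Qed.

Variable R : realType.

(** Inclusion-exclusion over the coordinates that reach q. In the induction, summing over one
    coordinate telescopes and Pascal's rule merges the two sums; truncated subtraction annihilates
    the terms with i q >= t. *)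
Lemma box_countE n q t : (box_count n q t)%:R =
  \sum_(i < n.+1) (-1) ^+ i * 'C(n, i)%:R * (simplex_count n (t - i * q))%:R :> R.
Proof.
elim: n t => [|n IHn] t.
  by rewrite big_ord1 box_count0 /= mul0n subn0 expr0 bin0 !mul1r.
rewrite box_countS natr_sum.
under eq_bigr do rewrite IHn.
rewrite exchange_big /=.
pose b i : R := (simplex_count n.+1 (t - i * q))%:R.
rewrite (eq_bigr (fun i : 'I_n.+1 => (-1) ^+ i * 'C(n, i)%:R * (b i - b i.+1))); last first.
  move=> i _; rewrite -mulr_sumr; congr (_ * _); rewrite /b.
  rewrite [in X in X - _](simplex_count_sum n q) natrD natr_sum mulSn addnC subnDA addrC addKr.
  by apply: eq_bigr => j _; rewrite -!subnDA addnC.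
rewrite [RHS]big_ord_recl /= expr0 bin0 !mul1r.
under [X in _ = _ + X]eq_bigr do rewrite /bump /= add1n binS natrD mulrDr mulrDl.
rewrite big_split /= addrA.
under eq_bigr do rewrite mulrBr.
rewrite sumrB; congr (_ + _); last first.
  by rewrite -sumrN; apply: eq_bigr => i _; rewrite exprS mulN1r !mulNr.
rewrite big_ord_recl /= expr0 bin0 !mul1r; congr (_ + _).
rewrite [RHS]big_ord_recr /= bin_small // mulr0 mul0r addr0.
by apply: eq_bigr => i _; rewrite /bump /= add1n.
Qed.

(** Positive parts extend the sum to all i and mirror the truncated subtraction in [box_countE], so
    that the two formulas can be compared term by term. *)
Lemma cube_volE n (s : R) : 0 <= s -> s <= n.+1%:R ->
  cube_vol n.+1 s =
  \sum_(i < n.+2) (-1) ^+ i * 'C(n.+1, i)%:R * (Num.max (s - i%:R) 0 ^+ n.+1 / n.+1`!%:R).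
Proof.
move=> s0 sn; rewrite -(big_mkord xpredT (fun i => (-1) ^+ i * 'C(n.+1, i)%:R *
  (Num.max (s - i%:R) 0 ^+ n.+1 / n.+1`!%:R))).
have ts : (Num.truncn s <= n.+1)%N by rewrite -(ler_nat R) (le_trans _ sn) // truncn_le.
rewrite (bigID (fun i => (i < (Num.truncn s).+1)%N)) /= [X in _ = _ + X]big1 ?addr0.
  rewrite -(big_nat_widen 0 _ _ xpredT) //; apply: eq_big_nat => i /andP[_].
  rewrite ltnS => its; have is_ : i%:R <= s by rewrite -truncn_ge_nat.
  rewrite (max_idPl _) ?subr_ge0 // -!mulrA; congr (_ * _).
  by rewrite mulrCA [_^-1 * _]mulrC.
move=> i; rewrite -leqNgt => tsi.
rewrite (max_idPr _) ?expr0n ?mul0r ?mulr0 // subr_le0.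
by rewrite ltW // -truncn_lt_nat.
Qed.

Lemma ler_dist_exp m (x y Z : R) : 0 <= x <= Z -> 0 <= y <= Z ->
  `|x ^+ m.+1 - y ^+ m.+1| <= m.+1%:R * Z ^+ m * `|x - y|.
Proof.
move=> /andP[x0 xZ] /andP[y0 yZ]; rewrite subrXX normrM mulrC ler_wpM2r //.
apply: le_trans (ler_norm_sum _ _ _) _.
rewrite mulrC -[m.+1 in X in _ <= X]card_ord mulr_natr -sumr_const; apply: ler_sum => i _.
have im : (i <= m)%N by rewrite -ltnS.
rewrite /= normrM !normrX !ger0_norm // -[X in _ <= _ ^+ X](subnK im) exprD.
by apply: ler_pM; rewrite ?exprn_ge0 // lerXn2r // nnegrE (le_trans _ xZ).
Qed.

Lemma simplex_count_bounds m t :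
  (t ^ m.+1 <= simplex_count m.+1 t * m.+1`! <= (t + m) ^ m.+1)%N.
Proof.
rewrite /= bin_ffact ffact_prod -[X in (t ^ X)%N]card_ord -[X in ((t + m) ^ X)%N]card_ord.
rewrite -!prod_nat_const; apply/andP; split; apply: leq_prod => i _; last exact: leq_subr.
by rewrite -addnBA ?leq_addr // -ltnS.
Qed.


Lemma simplex_count_asym m (c : R) : 0 <= c -> exists2 M : R, 0 <= M &
  forall (q y : nat) (Y : R), (0 < q)%N -> 0 <= Y -> Y <= m.+1%:R * q%:R ->
    `|y%:R - Y| <= c ->
    `|(simplex_count m.+1 y)%:R - Y ^+ m.+1 / m.+1`!%:R| <= M * q%:R ^+ m.
Proof.
(* Since q >= 1, [Z0 * q%:R] bounds Y, y and y + m at once. *)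
move=> c0; pose Z0 : R := m.+1%:R + c + m%:R.
have Z00 : 0 <= Z0 by rewrite !addr_ge0.
exists (m.+1%:R * Z0 ^+ m * (c + m%:R)).
  by rewrite !mulr_ge0 ?addr_ge0 ?exprn_ge0.
move=> q y Y q0 Y0 Yq yY.
have F0 : 0 < m.+1`!%:R :> R by rewrite ltr0n fact_gt0.
have F1 : 1 <= m.+1`!%:R :> R by rewrite ler1n fact_gt0.
have q1 : 1 <= q%:R :> R by rewrite ler1n.
pose Z := Z0 * q%:R.
have ZE : Z = m.+1%:R * q%:R + c * q%:R + m%:R * q%:R by rewrite /Z /Z0 !mulrDl.
have cq : c <= c * q%:R by rewrite ler_peMr.
have mq : m%:R <= m%:R * q%:R :> R by rewrite ler_peMr.
have [yl yu] : Y - c <= y%:R /\ y%:R <= Y + c by move: yY; rewrite ler_distlC; lra.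
have y0 : 0 <= y%:R :> R by [].
have m0 : 0 <= m%:R :> R by [].
have YZ : 0 <= Y <= Z by rewrite ZE; lra.
have yZ : 0 <= (y%:R : R) <= Z by rewrite ZE; lra.
have ymZ : 0 <= ((y + m)%:R : R) <= Z by rewrite ZE natrD; lra.
have D1 := ler_dist_exp m yZ YZ; have D2 := ler_dist_exp m ymZ YZ.
set E := m.+1%:R * Z0 ^+ m * _ * _.
have EE : m.+1%:R * Z ^+ m * (c + m%:R) = E by rewrite /E /Z exprMn; ring.
have W0 : 0 <= m.+1%:R * Z ^+ m by rewrite mulr_ge0 ?exprn_ge0 //; case/andP: YZ; lra.
have {}D1 : `|y%:R ^+ m.+1 - Y ^+ m.+1| <= E.
  by apply: le_trans D1 _; rewrite -EE ler_wpM2l //; lra.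
have {}D2 : `|(y + m)%:R ^+ m.+1 - Y ^+ m.+1| <= E.
  apply: le_trans D2 _; rewrite -EE ler_wpM2l // natrD addrAC.
  by apply: le_trans (ler_normD _ _) _; rewrite [`|m%:R|]ger0_norm //; lra.
have /andP[] := simplex_count_bounds m y.
rewrite -2!(ler_nat R) natrM !natrX => L1 L2.
suff H : `|(simplex_count m.+1 y)%:R * m.+1`!%:R - Y ^+ m.+1| <= E.
  rewrite -[X in `|X - _|](mulfK (lt0r_neq0 F0)) -mulrBl normrM normfV.
  rewrite (gtr0_norm F0) ler_pdivrMr //; apply: le_trans H _.
  by rewrite ler_peMr // (le_trans _ D1).
move: D1 D2; rewrite !ler_distlC; lra.
Qed.

(** The slack c absorbs both the rounding of t and the shift by d. The error has order q^m, one less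
    than the main term, with M independent of q, t and s. *)
Lemma box_count_asym m (c : R) : 0 <= c -> exists2 M : R, 0 <= M &
  forall (q t : nat) (s : R), (0 < q)%N -> 0 <= s -> s <= m.+1%:R ->
    `|t%:R - s * q%:R| <= c ->
    `|(box_count m.+1 q t)%:R - q%:R ^+ m.+1 * cube_vol m.+1 s| <= M * q%:R ^+ m.
Proof.
move=> c0; have [M M0 HM] := simplex_count_asym m c0.
exists (\sum_(i < m.+2) 'C(m.+1, i)%:R * M).
  by apply: sumr_ge0 => i _; rewrite mulr_ge0.
move=> q t s q0 s0 sm ts; rewrite box_countE cube_volE // mulr_sumr -sumrB.
apply: le_trans (ler_norm_sum _ _ _) _; rewrite mulr_suml; apply: ler_sum => i _.
rewrite mulrCA -mulrBr !normrM normrX normrN1 expr1n mul1r.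
rewrite ger0_norm // -mulrA ler_wpM2l //.
have q0R : 0 < q%:R :> R by rewrite ltr0n.
pose Y : R := Num.max (s * q%:R - i%:R * q%:R) 0.
have YE : q%:R * Num.max (s - i%:R) 0 = Y.
  by rewrite maxr_pMr ?ltW // mulr0 mulrBr ![q%:R * _]mulrC.
rewrite mulrA -exprMn YE; apply: HM => //; first by rewrite le_max lexx orbT.
  rewrite ge_max mulr_ge0 // andbT.
  apply: (@le_trans _ _ (s * q%:R)); last by rewrite ler_wpM2r.
  by rewrite lerBlDr lerDl mulr_ge0.
have -> : (t - i * q)%:R = Num.max (t%:R - i%:R * q%:R) 0 :> R.
  rewrite -natrM; have [le|/ltnW le] := leqP (i * q) t.
    by rewrite natrB // (max_idPl _) // subr_ge0 ler_nat.
  by rewrite (eqP le) (max_idPr _) // subr_le0 ler_nat.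
(* Taking positive parts is 1-Lipschitz. *)
apply: le_trans ts; rewrite /Y.
move: (t%:R) (s * q%:R) (i%:R * q%:R) => a b u.
rewrite /Num.max; case: ltP => h1; case: ltP => h2; rewrite ler_norml;
  have [h|h] := lerP 0 (a - b); rewrite ?(ger0_norm h) ?(ltr0_norm h); lra.
Qed.

Definition mid_vol n : R :=
  cube_vol n ((n%:R + 1) / 2) - cube_vol n ((n%:R - 1) / 2).

(** The subcube of side 2r with lowest corner (mr, ..., mr) lies in the slab: its coordinate sums
    run from t to t + (m+1)(2r-1), which is below t + q. *)
Lemma box_count_mid_lower m r : (0 < r)%N ->
  ((2 * r) ^ m.+1 + box_count m.+1 (2 * m.+1 * r) (m.+1 * m * r) <=
   box_count m.+1 (2 * m.+1 * r) (m.+1 * m * r + 2 * m.+1 * r))%N.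
Proof.
move=> r0; set q := (2 * m.+1 * r)%N; set t := (m.+1 * m * r)%N.
have lt (b : 'I_(2 * r)) : (m * r + b < q)%N.
  by have := ltn_ord b; rewrite /q; nia.
pose F (b : {ffun 'I_m.+1 -> 'I_(2 * r)}) : {ffun 'I_m.+1 -> 'I_q} :=
  [ffun i => Ordinal (lt (b i))].
have Finj : injective F.
  move=> b b' /ffunP E; apply/ffunP => i; apply/val_inj; have := congr1 val (E i).
  by rewrite !ffunE /=; exact: addnI.
have Fsum b : (\sum_i F b i)%N = (t + \sum_i b i)%N.
  under eq_bigr do rewrite ffunE /=.
  by rewrite big_split sum_nat_const card_ord /= /t mulnA.
have <- : #|codom F| = ((2 * r) ^ m.+1)%N.
  by rewrite card_codom // card_ffun !card_ord.
pose L : pred {ffun 'I_m.+1 -> 'I_q} := fun a => (\sum_i a i < t)%N.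
have := cardUI [pred a in codom F] [pred a | L a].
have -> : #|[predI [pred a in codom F] & [pred a | L a]]| = 0%N.
  apply: eq_card0 => a; rewrite !inE; apply/negP => /andP[/codomP[b ->]].
  by rewrite /L Fsum; lia.
have <- : #|[pred a in codom F]| = #|codom F| by exact: eq_card.
rewrite addn0 => <-; apply: subset_leq_card; apply/fintype.subsetP => a.
rewrite !inE => /orP[/codomP[b ->]|]; last by rewrite /L; lia.
rewrite Fsum ltn_add2l; suff: (\sum_i b i <= \sum_(i < m.+1) (2 * r).-1)%N.
  rewrite sum_nat_const card_ord => /leq_ltn_trans; apply.
  by rewrite /q -mulnA mulnCA ltn_mul2l /=; lia.
by apply: leq_sum => i _; have := ltn_ord (b i); lia.
Qed.

Lemma archi_le (a b M : R) : (forall k : nat, a <= b + M / k.+1%:R) -> a <= b.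
Proof.
move=> H; rewrite leNgt; apply/negP => ba.
have ab0 : 0 < a - b by rewrite subr_gt0.
pose k := Num.truncn (M / (a - b)).
have : M / (a - b) < k.+1%:R by exact: truncnS_gt.
rewrite ltr_pdivrMr // mulrC -ltr_pdivrMr ?ltr0n // => kM.
move: kM (H k); set x := M / _ => kM Hk.
by lra.
Qed.

(** The subcube of the preceding count has relative side 1/(m+1), which gives the explicit lower
    bound. With q = 2(m+1)r the ratio t/q is exactly m/2, so the asymptotics apply with slack 0. *)
Lemma mid_vol_gt0 m : 0 < mid_vol m.+1.
Proof.
have [M M0 HM] := box_count_asym m (lexx 0).
pose N : R := m.+1%:R; have N0 : 0 < N by rewrite ltr0n.
have m0 : 0 <= m%:R :> R by [].
have NE : N = m%:R + 1 by rewrite /N natr1.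
suff: N^-1 ^+ m.+1 <= mid_vol m.+1.
  by apply: lt_le_trans; rewrite exprn_gt0 // invr_gt0.
apply: (@archi_le _ _ (M / N)) => k; set r := k.+1.
pose q := (2 * m.+1 * r)%N; pose t := (m.+1 * m * r)%N.
have r0 : 0 < r%:R :> R by rewrite ltr0n.
have q0 : (0 < q)%N by rewrite /q; lia.
have q0R : 0 < q%:R :> R by rewrite ltr0n.
have qE : q%:R = 2 * N * r%:R :> R by rewrite /q !natrM.
have tE : t%:R = N * m%:R * r%:R :> R by rewrite /t !natrM.
have := HM q t ((N - 1) / 2) q0; have := HM q (t + q)%N ((N + 1) / 2) q0.
rewrite natrD tE qE.
have -> : N * m%:R * r%:R + 2 * N * r%:R - (N + 1) / 2 * (2 * N * r%:R) = 0.
  by rewrite NE; field.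
have -> : N * m%:R * r%:R - (N - 1) / 2 * (2 * N * r%:R) = 0 by rewrite NE; field.
rewrite normr0 -qE !ler_distlC => /(_ _ _ _)/andP[]; rewrite ?lexx -?/N ?NE //; try lra.
rewrite -NE => L1 _ /(_ _ _ _)/andP[]; rewrite ?lexx -?/N ?NE //; try lra.
rewrite -NE => _ L2.
have := box_count_mid_lower m (ltn0Sn k).
rewrite -/q -/t -(ler_nat R) natrD natrX natrM -/r => L3.
rewrite -(ler_pM2l (exprn_gt0 m.+1 q0R)) mulrDr.
have -> : q%:R ^+ m.+1 * N^-1 ^+ m.+1 = (2 * r%:R) ^+ m.+1.
  by rewrite -exprMn qE; congr (_ ^+ _); field; lra.
have -> : q%:R ^+ m.+1 * (M / N / r%:R) = 2 * (M * q%:R ^+ m).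
  by rewrite exprSr {2}qE; field; lra.
rewrite /mid_vol -/N mulrBr; lra.
Qed.

Lemma mid_vol_le (p m d mu tau : nat) : (1 < p)%N ->
  (forall e t, (d <= p ^ e)%N ->
     (mu * box_count m.+1 (p ^ e) (t + p ^ e - d) <=
      (p ^ e) ^ m.+1 * tau + mu * box_count m.+1 (p ^ e) t)%N) ->
  mu%:R * mid_vol m.+1 <= tau%:R.
Proof.
move=> p1 H; have d0 : 0 <= d%:R + 1 :> R by rewrite addr_ge0.
have [M M0 HM] := box_count_asym m d0.
pose N : R := m.+1%:R; have N0 : 0 < N by rewrite ltr0n.
have m0 : 0 <= m%:R :> R by [].
have NE : N = m%:R + 1 by rewrite /N natr1.
apply: (@archi_le _ _ (2 * mu%:R * M)) => k.
(* This exponent gives both q >= d, so that H applies, and q >= k+1, so that an error of size 1/q is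
   at most one of size 1/(k+1). *)
have kq : (d + k.+1 <= p ^ (d + k.+1))%N by exact/ltnW/ltn_expl.
move: (p ^ _)%N kq (fun t => H (d + k.+1)%N t) => q kq {}H.
(* With n = m+1, t is within 1/2 of (n-1)q/2, hence t+q-d is within d+1 of (n+1)q/2. *)
pose t := (m * q)./2.
have dq : (d <= q)%N by lia.
have q0 : (0 < q)%N by lia.
have q0R : 0 < q%:R :> R by rewrite ltr0n.
have dqR : d%:R <= q%:R :> R by rewrite ler_nat.
have tlN : (m * q <= 2 * t + 1)%N by rewrite /t; move: (m * q)%N => x; lia.
have tuN : (2 * t <= m * q)%N by rewrite /t; move: (m * q)%N => x; lia.
move: tlN tuN; rewrite -!(ler_nat R) natrD !natrM => tl tu.
have := HM q t ((N - 1) / 2) q0; have := HM q (t + q - d)%N ((N + 1) / 2) q0.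
rewrite natrB ?natrD; last by rewrite (leq_trans dq) ?leq_addl.
have E1 : `|t%:R + q%:R - d%:R - (N + 1) / 2 * q%:R| <= d%:R + 1.
  rewrite NE; have dn0 : 0 <= d%:R :> R by [].
  move: tl tu dn0; clear; move: (t%:R) (q%:R) (m%:R) (d%:R) => a b u v tl tu v0.
  by rewrite ler_norml; apply/andP; split; lra.
have E0 : `|t%:R - (N - 1) / 2 * q%:R| <= d%:R + 1.
  rewrite NE; have dn0 : 0 <= d%:R :> R by [].
  move: tl tu dn0; clear; move: (t%:R) (q%:R) (m%:R) (d%:R) => a b u v tl tu v0.
  by rewrite ler_norml; apply/andP; split; lra.
have s1 : 0 <= (N + 1) / 2 <= m.+1%:R by rewrite -/N NE; lra.
have s0 : 0 <= (N - 1) / 2 <= m.+1%:R by rewrite -/N NE; lra.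
case/andP: s1 => s1l s1u; case/andP: s0 => s0l s0u.
move=> /(_ s1l s1u E1) + /(_ s0l s0u E0); rewrite !ler_distlC.
move=> /andP[_ L1] /andP[L0 _].
have := H t dq; rewrite -(ler_nat R) natrD !natrM natrX => L2.
rewrite -(ler_pM2l (exprn_gt0 m.+1 q0R)).
have kR : 0 < k.+1%:R :> R by rewrite ltr0n.
apply: (@le_trans _ _ (q%:R ^+ m.+1 * (tau%:R + 2 * mu%:R * M / q%:R))); last first.
  rewrite ler_pM2l ?exprn_gt0 // lerD2l ler_wpM2l ?mulr_ge0 // lef_pV2 ?posrE //.
  by rewrite ler_nat (leq_trans _ kq) ?leq_addl.
have -> : q%:R ^+ m.+1 * (tau%:R + 2 * mu%:R * M / q%:R) =
    q%:R ^+ m.+1 * tau%:R + mu%:R * (2 * (M * q%:R ^+ m)).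
  have id x u v w : x != 0 :> R -> x ^+ m.+1 * (u + 2 * v * w / x) =
      x ^+ m.+1 * u + v * (2 * (w * x ^+ m)).
    by move=> x0; rewrite exprSr; field.
  by rewrite id // gt_eqF.
have mu0 : 0 <= mu%:R :> R by [].
rewrite mulrCA /mid_vol -/N mulrBr.
set V1 := _ * cube_vol _ _ in L1 *; set V0 := _ * cube_vol _ _ in L0 *.
have: mu%:R * (V1 - V0) <= mu%:R * ((box_count m.+1 q (t + q - d))%:R
    - (box_count m.+1 q t)%:R + 2 * (M * q%:R ^+ m)).
  by rewrite ler_wpM2l //; lra.
by rewrite !mulrDr !mulrN; lra.
Qed.

End Counting.

(** * Reductions of ideals *)

Section Reductions.
Variables (A : comNzRingType) (I J : set A) (d : nat).
Hypothesis red : ipow I d.+1 `<=` ideal_mul J (ipow I d).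

(** Each use of [red] turns one factor I into a factor J while the reserve I^d is restored. *)
Lemma ipow_reduction j : ipow I (j + d) `<=` ideal_mul (ipow J j) (ipow I d).
Proof.
have iS i : is_ideal (ideal_mul (ipow J i) (ipow I d)).
  exact/ideal_mul_ideal/ipow_ideal.
elim: j => [|j IHj]; first by move=> a da; rewrite -[a]mul1r; exact: ideal_mulI.
apply: ideal_mul_min => // a b Ia /IHj.
suff: ideal_mul (ipow J j) (ipow I d) `<=`
    [set b | ideal_mul (ipow J j.+1) (ipow I d) (a * b)] by apply.
apply: ideal_mul_min; first exact: colon_ideal.
move=> x y jx dy /=; rewrite mulrCA.
have : ipow I d.+1 (a * y) by exact: ideal_mulI.
move=> /red; suff: ideal_mul J (ipow I d) `<=`
    [set z | ideal_mul (ipow J j.+1) (ipow I d) (x * z)] by apply.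
apply: ideal_mul_min; first exact: colon_ideal.
move=> z w Jz dw /=; rewrite mulrA; apply: ideal_mulI => //; rewrite mulrC.
exact: ideal_mulI.
Qed.

Lemma ideal_mul_subl (I1 I2 : set A) : is_ideal I1 -> ideal_mul I1 I2 `<=` I1.
Proof.
move=> i1; apply: ideal_mul_min => // a b Ia _; rewrite mulrC.
by case: i1 => _ _; apply.
Qed.

Lemma reduction_exp x j : I x -> ipow J j (x ^+ (j + d)).
Proof.
move=> Ix; apply: (@ideal_mul_subl _ (ipow I d)); first exact: ipow_ideal.
by apply: ipow_reduction; exact: ipowX.
Qed.

End Reductions.

(** Any monomial of degree d+1 other than f^(d+1) contains some g_t and is already in J I^d. A
    single membership thus encodes the reduction, and a single equation has to be specialized. *)
Lemma reduction_of_exp (A : comNzRingType) (T : finType) (g : T -> A) (f : A) d :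
  let I := idl (fun i : option T => oapp g f i) in
  ideal_mul (idl g) (ipow I d) (f ^+ d.+1) ->
  ipow I d.+1 `<=` ideal_mul (idl g) (ipow I d).
Proof.
move=> I fd; apply: ipow_gen_min; first exact/ideal_mul_ideal/ipow_ideal.
move=> a ad; have [/forallP a0|] := boolP [forall t, a (Some t) == 0%N].
  rewrite (bigD1 None) //= [X in _ * X]big1 ?mulr1 => [|[t|] //= _].
    rewrite (bigD1 None) //= big1 ?addn0 in ad; first by rewrite ad.
    by move=> [t|] // _; apply/eqP.
  by rewrite (eqP (a0 t)).
rewrite negb_forall => /existsP[t at0].
rewrite (bigD1 (Some t)) //= -(prednK (n := a (Some t))) ?lt0n // exprS -mulrA.
apply: ideal_mulI; first exact: idl_gen.
rewrite (_ : _ * _ = \prod_i oapp g f i ^+ (if i == Some t then (a i).-1 else a i)).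
  apply: ipow_mono; rewrite -ltnS -ad (bigD1 (Some t)) //= -(prednK (n := a (Some t))) ?lt0n //.
  rewrite addSn ltnS [leqRHS](bigD1 (Some t)) //= eqxx leq_add2l; apply: leq_sum => i /negbTE ->.
  exact: leqnn.
rewrite [RHS](bigD1 (Some t)) //= eqxx; congr (_ * _).
by apply: eq_bigr => i /negbTE ->.
Qed.

Theorem char_p_bound (R : realType) (m : nat) (K : fieldType) (p : nat)
    (g : 'I_m.+1 -> mfps m.+1 K) (f : mfps m.+1 K) (d : nat)
    (T S : finType) (E : T -> mfps m.+1 K) (U : S -> mfps m.+1 K) :
  p \in [pchar K] -> (forall x : K, exists y, y ^+ p = x) ->
  let I := idl (fun i => oapp g f i) in
  spans (idl g) E -> indep (idl g) E -> spans I U ->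
  ideal_mul (idl g) (ipow I d) (f ^+ d.+1) ->
  #|T|%:R * mid_vol R m.+1 <= #|S|%:R.
Proof.
move=> pK perfect I sE iE sU fd.
apply: (@mid_vol_le R p m d) => [|e t dq]; first by case/andP: pK => /prime_gt1.
apply: (char_p_count pK perfect sE iE sU) => // j.
exact: (reduction_exp (reduction_of_exp fd)) (idl_gen _ None).
Qed.

(** * Fibre relations *)

Lemma order_ge_mons n (K : comNzRingType) s :
  order_ge (n := n) (K := K) s = idl (@mons _ _ (@mfps_X n K) s).
Proof. by rewrite order_ge_ipow ipow_idl. Qed.

(** If no m^k were contained in I, Nakayama would give for every k a z_k in m^k outside I + m^(k+1).
    Looking at the lowest nonzero coefficient shows the z_k independent modulo I, against finite
    codimension. *)
Lemma finite_codim_order_ge n (K : fieldType) (I : set (mfps n K)) (T : finType)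
    (e : T -> mfps n K) : is_ideal I -> spans I e -> exists N, order_ge N `<=` I.
Proof.
move=> iI se; apply: contrapT => noN.
have H k : exists z, order_ge k z /\ ~ ideal_add I (order_ge k.+1) z.
  apply: contrapT => noz; apply: noN; exists k; rewrite order_ge_mons.
  apply: nakayama => //; rewrite -order_ge_mons => z kz.
  have [[a Ia [b kb <-]]|nz] := pselect (ideal_add I (order_ge k.+1) z); last first.
    by case: noz; exists z.
  exists a => //; exists b => //; move: kb; rewrite order_ge_ipow.
  apply: ideal_mul_min; first exact/ideal_mul_ideal/order_ge_ideal.
  move=> x y x1 ky; apply: ideal_mulI; last by rewrite order_ge_ipow.
  by rewrite order_ge_ipow ipow1 //; exact: idl_ideal.
have {H}/choice[z Hz] := H.
have iz : indep I (fun k : 'I_#|T|.+1 => z k).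
  move=> c Ic k; have [j] := ubnP (k : nat); elim: j k => // j IHj k kj.
  have c0 (l : 'I_#|T|.+1) : (l < k)%N -> c l = 0.
    by move=> lk; apply: IHj; exact: (leq_trans lk).
  apply: contrapT => /eqP ck; case: (Hz k) => _; apply.
  have iS := ideal_add_ideal iI (order_ge_ideal n K k.+1).
  rewrite -[z k](scalerK (a := c k)) ?unitfE // -[_ *: _]mul1r -scalerAr scalerAl.
  have [_ _] := iS; apply.
  have -> : c k *: z k = \sum_i c i *: z i - \sum_(i | i != k) c i *: z i.
    by rewrite [in RHS](bigD1 k) //= addrK.
  apply: idealB => //; first exact: ideal_addl (order_ge_ideal _ _ _) _ Ic.
  apply: ideal_sum => // i ik; have [ik'|ki] := ltnP i k.
    by rewrite c0 // scale0r; case: iS.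
  rewrite -[_ *: _]mul1r -scalerAr scalerAl; have [_ _] := iS; apply.
  apply: ideal_addr => //; apply: (@order_ge_le _ _ _ i); last by case: (Hz i).
  by rewrite ltn_neqAle ki eq_sym andbT.
have sI : subspace I by split=> [|a u v]; [case: iI|exact: ideal_subspace].
by have := indep_spans_leq sI iz se; rewrite card_ord ltnn.
Qed.

Lemma card_bmultinom_le n s : (#|{: bmultinom n s}| <= s ^ n)%N.
Proof.
have lt (b : bmultinom n s) i : (b i < s)%N.
  apply: leq_ltn_trans (bmdeg b); rewrite mdegE (bigD1 i) //=.
  exact: leq_addr.
pose F (b : bmultinom n s) : {ffun 'I_n -> 'I_s} := [ffun i => Ordinal (lt b i)].
have Finj : injective F.
  move=> b b' /ffunP E; apply/eqP; rewrite bmeqP; apply/eqP/mnmP => i.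
  by have := congr1 val (E i); rewrite !ffunE.
by have := leq_card F Finj; rewrite card_ffun !card_ord.
Qed.

Lemma expansion_inj k m (a b : 'I_m -> nat) :
  (forall i, (a i < k)%N) -> (forall i, (b i < k)%N) ->
  (\sum_i a i * k ^ i = \sum_i b i * k ^ i)%N -> a =1 b.
Proof.
elim: m a b => [|m IHm] a b ak bk; first by move=> _ [].
have k0 : (0 < k)%N := leq_ltn_trans (leq0n _) (ak ord0).
have S (c : 'I_m.+1 -> nat) :
    (\sum_i c i * k ^ i = (\sum_(i < m) c (lift ord0 i) * k ^ i) * k + c ord0)%N.
  rewrite big_ord_recl expn0 muln1 addnC big_distrl /=; congr (_ + _)%N.
  by apply: eq_bigr => i _; rewrite /bump add1n expnSr mulnA.
rewrite !S => E.
have E0 : a ord0 = b ord0.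
  by have := congr1 (modn^~ k) E; rewrite !modnMDl !modn_small.
move: E; rewrite E0 => /addIn/eqP; rewrite eqn_pmul2r // => /eqP/IHm IH.
move=> i; case: (unliftP ord0 i) => [j ->|->] //.
by apply: IH => l.
Qed.

(* Kronecker's substitution, x_t = x ^+ (k ^ t), keeps the monomials with
   exponents below k apart. *)
Lemma poly_nonvanishing (K : fieldType) (T : finType) k
    (c : {ffun T -> 'I_k} -> K) :
  (forall P : {poly K}, P != 0 -> exists x, P.[x] != 0) ->
  (exists a, c a != 0) ->
  exists x : T -> K, (forall t, x t != 0) /\ \sum_a c a * \prod_t x t ^+ a t != 0.
Proof.
move=> Kinf [a0 ca0].
pose ex (a : {ffun T -> 'I_k}) := (\sum_t a t * k ^ enum_rank t)%N.
have exE a : ex a = (\sum_(i < #|T|) a (enum_val i) * k ^ i)%N.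
  rewrite /ex (reindex_onto (@enum_val T T) enum_rank) /= => [|t _]; last exact: enum_rankK.
  by apply: eq_big => [i|i _]; rewrite enum_valK ?eqxx.
have ex_inj : injective ex.
  move=> a b; rewrite !exE => /expansion_inj E; apply/ffunP => t; apply/val_inj.
  by rewrite -[t]enum_rankK; apply: E => i.
pose P := \sum_a c a *: 'X^(ex a) : {poly K}.
(* The factor 'X forces the chosen point to be nonzero, hence all coordinates [x t] to be
   nonzero. *)
have P0 : 'X * P != 0.
  rewrite mulf_neq0 ?polyX_eq0 //; apply/eqP => /(congr1 (fun p : {poly K} => p`_(ex a0))).
  rewrite coef_sum (bigD1 a0) //= coefZ coefXn eqxx mulr1 big1 ?addr0 => [|a aa0].
    by rewrite coef0; apply/eqP.
  by rewrite coefZ coefXn eq_sym (inj_eq ex_inj) (negbTE aa0) mulr0.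
have [x] := Kinf _ P0; rewrite hornerM hornerX mulf_eq0 negb_or => /andP[x0 Px].
exists (fun t => x ^+ (k ^ enum_rank t)); split=> [t|]; first exact: expf_neq0.
move: Px; rewrite horner_sum; congr (_ != _); apply: eq_bigr => a _.
rewrite hornerZ hornerXn -prodrXr; congr (_ * _); apply: eq_bigr => t _.
by rewrite -exprM mulnC.
Qed.

Section Relation.
Variables (n : nat) (K : fieldType).
Local Notation R := (mfps n K).
Variables (T : finType) (h : T -> R) (N : nat).
Let I := idl h.
Hypothesis hI : order_ge N `<=` I.

(* There are k ^ #|T| monomials with exponents below k, and dim R / m^s is at
   most s ^ n; for s linear in k and k large, they are dependent modulo m^s. *)
Lemma monomial_relation : (n < #|T|)%N -> exists k (c : {ffun T -> 'I_k} -> K),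
  (exists a, c a != 0) /\
  ipow I (#|T| * k) (\sum_a c a *: \prod_t h t ^+ a t).
Proof.
(* With this k, s^n = (N #|T|)^n k^n < k^(n+1) <= k^#|T|. The shape of s places m^s in I^(#|T| k),
   and #|T| k exceeds the degree of every monomial involved. *)
move=> nT; pose k := ((N * #|T|) ^ n).+1; pose s := (N * (#|T| * k))%N.
have [c [Hc c0]] : exists c : {ffun T -> 'I_k} -> K,
    order_ge s (\sum_a c a *: \prod_t h t ^+ a t) /\ exists a, c a != 0.
  apply: contrapT => noc.
  have ind : indep (order_ge s) (fun a : {ffun T -> 'I_k} => \prod_t h t ^+ a t).
    move=> c Hc a; apply: contrapT => /eqP ca; apply: noc; exists c; split=> //.
    by exists a.
  have spn : spans (order_ge s) (fun b : bmultinom n s => monomial K b).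
    by move=> v; exists (fun b : bmultinom n s => mfps_coef v b); exact: trunc_order.
  have sub : subspace (order_ge (n := n) (K := K) s).
    split=> [|a u v]; first by case: (order_ge_ideal n K s).
    exact: (ideal_subspace _ (order_ge_ideal _ _ _)).
  have := leq_trans (indep_spans_leq sub ind spn) (card_bmultinom_le n s).
  rewrite card_ffun card_ord /s mulnA expnMn.
  apply/negP; rewrite -ltnNge; apply: (@leq_trans (k * k ^ n)).
    by rewrite ltn_pmul2r // expn_gt0.
  by rewrite -expnS leq_pexp2l.
exists k, c; split=> //; move: Hc; rewrite order_ge_ipow /s mulnC => /ipow_mul.
by apply: ipow_sub; rewrite -order_ge_ipow.
Qed.

(* The lowest-degree part of a relation, an element of the ideal of the special
   fibre of the Rees algebra. *)
Lemma fiber_relation : (n < #|T|)%N -> exists k d (c : {ffun T -> 'I_k} -> K),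
  [/\ exists a, c a != 0, forall a : {ffun T -> 'I_k}, (\sum_t a t)%N != d -> c a = 0 &
      ipow I d.+1 (\sum_a c a *: \prod_t h t ^+ a t)].
Proof.
move=> nT; have [k [c [[a ca] Hc]]] := monomial_relation nT.
pose P d := [exists a : {ffun T -> 'I_k}, (c a != 0) && ((\sum_t a t)%N == d)].
have exP : exists d, P d.
  by exists (\sum_t a t)%N; apply/existsP; exists a; rewrite ca eqxx.
case: (ex_minnP exP) => d /existsP[b /andP[cb /eqP bd]] dmin.
exists k, d, (fun a : {ffun T -> 'I_k} => if (\sum_t a t)%N == d then c a else 0); split.
- by exists b; rewrite bd eqxx.
- by move=> a' /negbTE ->.
have -> : \sum_(a' : {ffun T -> 'I_k}) (if (\sum_t a' t)%N == d then c a' else 0) *: \prod_t h t ^+ a' t =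
    \sum_a' c a' *: \prod_t h t ^+ a' t -
    \sum_(a' : {ffun T -> 'I_k} | (\sum_t a' t)%N != d) c a' *: \prod_t h t ^+ a' t.
  rewrite [in RHS](bigID (fun a' : {ffun T -> 'I_k} => (\sum_t a' t)%N == d)) /= addrK.
  rewrite [RHS]big_mkcond; apply: eq_bigr => a' _.
  by case: ifP => // _; rewrite scale0r.
have iS := ipow_ideal I d.+1; apply: (idealB iS).
  (* All exponents of b are below k, so its degree d is less than #|T| k. *)
  apply: ipow_le Hc; rewrite -bd.
  rewrite -sum_nat_const; have /card_gt0P[t _] : (0 < #|T|)%N by exact: leq_ltn_trans nT.
  rewrite (bigD1 t) //= [leqRHS](bigD1 t) //= -addSn; apply: leq_add => //.
  by apply: leq_sum => t' _; exact: ltnW.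
apply: (ideal_sum _ iS) => a' a'd; have [->|ca'] := eqVneq (c a') 0.
  by rewrite scale0r; case: iS.
rewrite -[_ *: _]mul1r -scalerAr scalerAl; have [_ _] := iS; apply.
apply: ipow_mono; rewrite ltn_neqAle eq_sym a'd; apply: dmin; apply/existsP.
by exists a'; rewrite ca' eqxx.
Qed.

End Relation.

(** * Choice of the unit *)

Section UnitChoice.
Variables (n : nat) (K : fieldType).
Local Notation R := (mfps n K).
Hypothesis Kinf : forall P : {poly K}, P != 0 -> exists x, P.[x] != 0.

Lemma idealZ (I : set R) (a : K) u : is_ideal I -> I u -> I (a *: u).
Proof. by move=> [_ _ IM] Iu; rewrite -[u]mul1r scalerAl; exact: IM. Qed.

Section Specialization.
Variables (T : finType) (h : T -> R) (gamma : T -> K) (f : R) (J : set R).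
Let I := idl h.
Hypotheses (If : I f) (hJ : forall t, J (h t - gamma t *: f)).

(** The allowed error when a product of s elements of I is compared with a multiple of f^s. In
    degree 0 no error is permitted, which starts the multiplicative induction. *)
Let Q s : set R := if s is s'.+1 then ideal_mul J (ipow I s') else [set 0].

Let Q_ideal s : is_ideal (Q s).
Proof.
case: s => [|s]; last exact/ideal_mul_ideal/ipow_ideal.
by split=> [|a b -> ->|c a ->] //=; rewrite ?addr0 ?mulr0.
Qed.

Let QM s t a b : Q s a -> ipow I t b -> Q (s + t) (a * b).
Proof.
case: s => [->|s] /= => [_|sa tb]; first by rewrite mul0r; case: (Q_ideal t).
move: sa; rewrite mulrC; apply: (ideal_mul_min (colon_ideal b (Q_ideal (s + t).+1))).
move=> x y Jx sy /=; rewrite mulrCA; apply: ideal_mulI => //.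
by rewrite mulrC; exact: ipowD.
Qed.

Let rel s u (al : K) := ipow I s u /\ Q s (u - al *: f ^+ s).

Let relM s t u v al be : rel s u al -> rel t v be -> rel (s + t) (u * v) (al * be).
Proof.
move=> [su Qu] [tv Qv]; split; first exact: ipowD.
have -> : u * v - (al * be) *: f ^+ (s + t) =
    (u - al *: f ^+ s) * v + (v - be *: f ^+ t) * (al *: f ^+ s).
  by rewrite !mulrBl exprD -scalerA -!scalerAl -!scalerAr [v * _]mulrC [f ^+ t * _]mulrC
    scalerA -scalerA [be *: (al *: _)]scalerA [be * al]mulrC -[(al * be) *: _]scalerA addrA subrK.
have [_ QD _] := Q_ideal (s + t); apply: QD; first exact: QM.
rewrite addnC; apply: QM => //; apply: idealZ; first exact: ipow_ideal.
exact: ipowX.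
Qed.

Let relX t k : rel k (h t ^+ k) (gamma t ^+ k).
Proof.
have rel0 : rel 0 1 1 by split=> //; rewrite scale1r expr0 subrr.
elim: k => [|k IHk]; first by [].
rewrite !exprS -add1n; apply: relM => //; split; first by rewrite ipow1; [exact: idl_gen|exact: idl_ideal].
by rewrite -[_ - _]mulr1; exact: ideal_mulI.
Qed.

(** Replacing one factor [h t] by [gamma t *: f] changes the product by an element of J times d
    factors in I. *)
Lemma monomial_specialize (a : T -> nat) d : (\sum_t a t)%N = d.+1 ->
  ideal_mul J (ipow I d) (\prod_t h t ^+ a t - (\prod_t gamma t ^+ a t) *: f ^+ d.+1).
Proof.
move=> ad; suff [_] : rel d.+1 (\prod_t h t ^+ a t) (\prod_t gamma t ^+ a t) by [].
rewrite -ad; have: forall r : seq T, rel (\sum_(t <- r) a t)%N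
    (\prod_(t <- r) h t ^+ a t) (\prod_(t <- r) gamma t ^+ a t).
  elim=> [|t r IHr]; last by rewrite !big_cons; exact: relM.
  by rewrite !big_nil; split=> //; rewrite scale1r expr0 subrr.
exact.
Qed.

End Specialization.

Lemma derivB i (f g : R) : mfps_deriv i (f - g) = mfps_deriv i f - mfps_deriv i g.
Proof. by apply: mfpsP => m; rewrite /= mulrnDl mulNrn. Qed.

Lemma derivZ i (c : K) (f : R) : mfps_deriv i (c *: f) = c *: mfps_deriv i f.
Proof. by apply: mfpsP => m; rewrite /= mulrnAr. Qed.

Lemma deriv_sum i (T : finType) (F : T -> R) :
  mfps_deriv i (\sum_t F t) = \sum_t mfps_deriv i (F t).
Proof.
apply: (big_morph (mfps_deriv i)) => [f g|]; apply: mfpsP => m /=.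
  exact: mulrnDl.
by rewrite mul0rn.
Qed.

Lemma deriv1 i : mfps_deriv i (1 : R) = 0.
Proof.
apply: mfpsP => m /=; case: eqP => [/mnmP/(_ i)|]; last by rewrite mul0rn.
by rewrite mnmDE mnm0E mnm1E eqxx addn1.
Qed.

Lemma derivX i j : mfps_deriv i (mfps_X K j) = (i == j)%:R :> R.
Proof.
apply: mfpsP => m /=; case: (i =P j) => [<-|ij].
  rewrite mfps_coef1 -[X in _ == X]add0m eqm_add2r; case: eqP => [->|]; last by rewrite mul0rn.
  by rewrite mnm0E.
case: eqP => [/mnmP/(_ i)|]; last by rewrite mul0rn.
by rewrite mnmDE !mnm1E eqxx addn1; case: eqP => // /esym.
Qed.

Variable f : R.
Let df i := mfps_deriv i f.
Let I := idl (oapp df f).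
Hypothesis I1 : I `<=` order_ge 1.
Variables (T : finType) (e : T -> R).
Hypothesis sI : spans I e.

(** For u = 1 - sum_i gamma_i x_i the product rule gives g_i = u df_i - gamma_i f. Modulo the g_i
    and m I every generator of I becomes a multiple of f, so the relation becomes Phi f^(d+1), which
    can be solved for f^(d+1) when Phi is nonzero. *)
Lemma reduction_by_unit : exists (u : R) (d : nat),
  let g i := mfps_deriv i (u * f) in
  [/\ u \is a GRing.unit, idl (oapp g f) = I &
      ipow I d.+1 `<=` ideal_mul (idl g) (ipow I d)].
Proof.
have iI : is_ideal I by exact: idl_ideal.
have [N NI] := finite_codim_order_ge iI sI.
have [k [d [c [cn0 cd Hc]]]] : exists k d (c : {ffun option 'I_n -> 'I_k} -> K),
  [/\ exists a, c a != 0, forall a : {ffun option 'I_n -> 'I_k}, (\sum_t a t)%N != d -> c a = 0 &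
      ipow I d.+1 (\sum_a c a *: \prod_t oapp df f t ^+ a t)].
  by apply: (fiber_relation NI); rewrite card_option card_ord.
have [x [x0 Px]] := poly_nonvanishing Kinf cn0.
(* The relation is homogeneous, so rescaling the point to have coordinate 1 at f keeps it off the
   zero set. *)
pose gamma t := x t / x None.
pose Phi := \sum_a c a * \prod_t gamma t ^+ a t.
have Phi0 : Phi != 0.
  have : x None ^+ d * Phi != 0.
    move: Px; congr (_ != _); rewrite mulr_sumr; apply: eq_bigr => a _.
    rewrite mulrCA; have [ad|/cd ->] := eqVneq (\sum_t a t)%N d; last by rewrite !mul0r.
    congr (_ * _); rewrite -ad -prodrXr -big_split; apply: eq_bigr => t _ /=.
    by rewrite -exprMn /gamma mulrC divfK.
  by rewrite mulf_eq0 negb_or => /andP[].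
pose u : R := 1 - \sum_i gamma (Some i) *: mfps_X K i.
pose g i := mfps_deriv i (u * f).
have du i : mfps_deriv i u = - (gamma (Some i) *: 1).
  rewrite /u derivB deriv1 sub0r deriv_sum (bigD1 i) //= derivZ derivX eqxx.
  rewrite big1 ?addr0 // => j ji; rewrite derivZ derivX eq_sym (negbTE ji).
  exact: scaler0.
have gE i : g i = u * df i - gamma (Some i) *: f.
  by rewrite /g derivM du mulNr -scalerAl mul1r addrC.
have X1 i : order_ge 1 (mfps_X K i : R).
  by rewrite order_ge_ipow ipow1; [exact: idl_gen|exact: idl_ideal].
have u1 : order_ge 1 (1 - u).
  rewrite /u subKr; apply: ideal_sum => [|i _]; first exact: order_ge_ideal.
  exact: (idealZ _ (order_ge_ideal _ _ _)).
have uU : u \is a GRing.unit.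
  apply: series_unit; move/order_ge1E: u1; rewrite mfps_coefB mfps_coef1 eqxx.
  by move/eqP; rewrite subr_eq0 => /eqP.
have Ig : idl (oapp g f) = I.
  rewrite eqEsubset; split; (apply: idl_min; first exact: idl_ideal) => -[i|] /=.
  - rewrite gE; apply: (idealB iI); last first.
      by apply: (idealZ _ iI); exact: (idl_gen _ None).
    by case: iI => _ _; apply; exact: (idl_gen _ (Some i)).
  - exact: (idl_gen _ None).
  - have iG := idl_ideal (oapp g f).
    have -> : df i = u^-1 * (g i + gamma (Some i) *: f) by rewrite gE subrK mulKr.
    have [_ GD GM] := iG; apply: GM; apply: GD; first exact: (idl_gen _ (Some i)).
    by apply: (idealZ _ iG); exact: (idl_gen _ None).
  - exact: (idl_gen _ None).
(* The unit u equals 1 only modulo m; the summand m I absorbs the difference and is removed by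
   Nakayama at the end. *)
pose J := ideal_add (idl g) (ideal_mul (order_ge 1) I).
have iJ : is_ideal J by apply: ideal_add_ideal; [exact: idl_ideal|exact: ideal_mul_ideal].
have hJ t : J (oapp df f t - gamma t *: f).
  case: t => [i|] /=; last first.
    by rewrite /gamma divff // scale1r subrr; case: iJ.
  exists (g i); first exact: idl_gen.
  exists ((1 - u) * df i); first by apply: ideal_mulI => //; exact: (idl_gen _ (Some i)).
  by rewrite gE; ring.
have If : I f by exact: (idl_gen _ None).
(* A relation of degree 0 would put the nonzero constant Phi into I, which lies in m. Below, the
   degree is [d.+1]. *)
case: d cd Hc => [|d] cd Hc.
  have I11 : I (\sum_a c a *: \prod_t oapp df f t ^+ a t) by rewrite ipow1 in Hc.
  have cE : Phi *: 1 = \sum_a c a *: \prod_t oapp df f t ^+ a t.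
    rewrite scaler_suml; apply: eq_bigr => a _.
    have [|/cd ->] := eqVneq (\sum_t a t)%N 0%N; last by rewrite mul0r !scale0r.
    move=> /eqP; rewrite sum_nat_eq0 => /forallP a0.
    by rewrite !big1 ?mulr1 // => t _; rewrite (eqP (a0 t)).
  have /I1/order_ge1E := I11; rewrite -cE mfps_coefZ mfps_coef1 eqxx mulr1 => P0.
  by rewrite P0 eqxx in Phi0.
exists u, d; split=> //.
pose Z := ideal_add (ideal_mul (idl g) (ipow I d)) (ideal_mul (order_ge 1) (ipow I d.+1)).
have iZ : is_ideal Z.
  by apply: ideal_add_ideal; apply/ideal_mul_ideal/ipow_ideal.
have iZ1 := @ideal_mul_ideal _ (idl g) _ (ipow_ideal I d).
have iZ2 := @ideal_mul_ideal _ (order_ge 1) _ (ipow_ideal I d.+1).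
have JZ : ideal_mul J (ipow I d) `<=` Z.
  apply: ideal_mul_min => // _ b [a ga [y Iy <-]] db.
  rewrite mulrDl; have [_ ZD _] := iZ; apply: ZD.
    by apply: ideal_addl => //; exact: ideal_mulI.
  apply: ideal_addr => //; rewrite mulrC.
  move: y Iy; apply: (ideal_mul_min (colon_ideal b iZ2)) => v w v1 Iw /=.
  rewrite (_ : b * (v * w) = v * (w * b)); last by ring.
  by apply: ideal_mulI => //; exact: ideal_mulI.
have IZ : ipow I d.+2 `<=` Z.
  move=> z dz; apply: ideal_addr => //; move: z dz; apply: ideal_mul_min => // a b Ia db.
  by apply: ideal_mulI => //; exact: I1.
have fZ : Z (f ^+ d.+1).
  rewrite -[f ^+ d.+1](scalerK (a := Phi)) ?unitfE //; apply: (idealZ _ iZ).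
  (* The first sum is the relation, in I^(d+2) and so in m I^(d+1); the second consists of
     specialization errors in J I^d. Both lie in Z. *)
  have -> : Phi *: f ^+ d.+1 = \sum_a c a *: \prod_t oapp df f t ^+ a t -
     \sum_a c a *: (\prod_t oapp df f t ^+ a t - (\prod_t gamma t ^+ a t) *: f ^+ d.+1).
    rewrite -sumrB scaler_suml; apply: eq_bigr => a _.
    by rewrite -scalerBr opprB addrC subrK scalerA.
  apply: (idealB iZ); first exact: IZ.
  apply: (ideal_sum _ iZ) => a _.
  have [ad|/cd ->] := eqVneq (\sum_t a t)%N d.+1; last by rewrite scale0r; case: iZ.
  apply: (idealZ _ iZ); apply: JZ; exact: (monomial_specialize If hJ ad).
have IdZ : ipow I d.+1 `<=` Z.
  apply: (ipow_gen_min iZ) => a ad.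
  rewrite -[X in Z X](subrK ((\prod_t gamma t ^+ a t) *: f ^+ d.+1)).
  have [_ ZD _] := iZ; apply: ZD; last exact: (idealZ _ iZ fZ).
  by apply: JZ; exact: (monomial_specialize If hJ ad).
have IdE : ipow I d.+1 = idl (@mons _ _ (oapp df f) d.+1) by exact: ipow_idl.
rewrite [X in X `<=` _]IdE; apply: nakayama => //; rewrite -IdE; exact: IdZ.
Qed.

End UnitChoice.

(** * Specialization to positive characteristic *)

Section Specializable.
Variable K : fieldType.

(* Avoiding the zeros of b is what makes the property pass to {poly D}. *)
Definition specializable (D : idomainType) (iota : {rmorphism D -> K}) : Prop :=
  forall b, iota b != 0 -> exists2 a : nat, (0 < a)%N &
    forall L : closedFieldType, a%:R != 0 :> L -> exists psi : {rmorphism D -> L},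
      (forall z, iota z = 0 -> psi z = 0) /\ psi b != 0.

(** Integers embed in K, and a = |b| expresses exactly that b survives in L. *)
Lemma specializable_int : [pchar K] =i pred0 ->
  specializable (intr : {rmorphism int -> K}).
Proof.
move=> K0 b b0; exists `|b|%N; first by rewrite absz_gt0; apply: contraNneq b0 => ->.
move=> L bL; exists (intr : {rmorphism int -> L}); split=> [[k|k] /eqP|] /=.
- by rewrite -pmulrn ((pcharf0P K).1 K0) => /eqP ->.
- by rewrite NegzE mulrNz oppr_eq0 -pmulrn ((pcharf0P K).1 K0).
- by case: b bL {b0} => k; rewrite ?NegzE ?mulrNz ?oppr_eq0 ?abszN.
Qed.

Section Adjoin.
Variables (D : idomainType) (iota : {rmorphism D -> K}) (c : K).

Let comm_c (L : fieldType) (f : {rmorphism D -> L}) (x : L) : commr_rmorph f x.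
Proof. by move=> z; exact: mulrC. Qed.

Definition adjoin : {rmorphism {poly D} -> K} := horner_morph (comm_c iota c).

Local Notation ev := adjoin.

Lemma adjoinE P : ev P = (map_poly iota P).[c]. Proof. by []. Qed.

Hypothesis sD : specializable iota.

Let psi_map (L : closedFieldType) (psi : {rmorphism D -> L}) (P : {poly D}) :
  (forall z, iota z = 0 -> psi z = 0) ->
  map_poly iota P = 0 -> map_poly psi P = 0.
Proof.
move=> ker P0; apply/polyP => i; rewrite coef_map coef0; apply: ker.
by have := congr1 (fun Q : {poly K} => Q`_i) P0; rewrite coef_map coef0.
Qed.

(** Some coefficient of B is nonzero in K. Once psi keeps it nonzero, the image of B is a nonzero
    polynomial over the closed field L, and X can be sent to any non-root. *)
Lemma specializable_transcendental :
  (forall P, ev P = 0 -> map_poly iota P = 0) -> specializable ev.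
Proof.
move=> tr B B0; have /eqP : map_poly iota B != 0.
  by apply: contraNneq B0 => B0; rewrite adjoinE B0 horner0.
move=> mB; have [j bj] : exists j, iota B`_j != 0.
  apply: contrapT => nj; apply: mB; apply/polyP => j; rewrite coef_map coef0.
  by apply: contrapT => /eqP bj; apply: nj; exists j.
have [a a0 Ha] := sD bj; exists a => // L aL; have [psi [ker psib]] := Ha L aL.
have /closed_nonrootP[r Br] : map_poly psi B != 0.
  apply: contraNneq psib => /(congr1 (fun Q : {poly L} => Q`_j)).
  by rewrite coef_map coef0 => ->.
exists (horner_morph (comm_c psi r)); split=> //= P P0.
by rewrite /horner_morph (psi_map ker (tr _ P0)) horner0.
Qed.

(** As [iota] may have a kernel, the leading coefficient of P can vanish in K; cutting P at the size
    of its image repairs this. *)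
Let trim (P : {poly D}) : map_poly iota P != 0 -> exists P',
  [/\ map_poly iota P' = map_poly iota P, iota (lead_coef P') != 0 & (size P' <= size P)%N].
Proof.
move=> P0; pose s := size (map_poly iota P); exists (take_poly s P).
have s0 : (0 < s)%N by rewrite size_poly_gt0.
have lP : iota (take_poly s P)`_s.-1 != 0.
  by rewrite coef_take_poly prednK // leqnn -coef_map -lead_coefE lead_coef_eq0.
have sE : size (take_poly s P) = s.
  apply/eqP; rewrite eqn_leq size_take_poly leqNgt /=; apply/negP => lt.
  by rewrite nth_default ?rmorph0 ?eqxx // -ltnS prednK in lP.
split; last by rewrite sE size_poly.
- apply/polyP => i; rewrite !coef_map coef_take_poly /=; case: ltnP => // iP.
  by rewrite rmorph0 -coef_map /= nth_default.
- by rewrite lead_coefE sE.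
Qed.

Section Algebraic.
Variable m : {poly D}.
Hypotheses (m0 : ev m = 0) (lm : iota (lead_coef m) != 0).
Hypothesis mmin : forall P, ev P = 0 -> (size P < size m)%N -> map_poly iota P = 0.

Let m_neq0 : m != 0.
Proof. by apply: contraNneq lm => ->; rewrite lead_coef0 rmorph0. Qed.

Let m_map : map_poly iota m != 0.
Proof.
apply: contraNneq lm => /(congr1 (fun Q : {poly K} => Q`_(size m).-1)).
by rewrite coef_map coef0 -lead_coefE => ->.
Qed.

(** Pseudo-division of P by m leaves a remainder killed by [ev] and shorter than m. By minimality
    its coefficients are in the kernel of [iota], hence of psi, and the power of the leading
    coefficient cancels. *)
Let psi_root (L : closedFieldType) (psi : {rmorphism D -> L}) (r : L) :
  (forall z, iota z = 0 -> psi z = 0) -> psi (lead_coef m) != 0 ->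
  root (map_poly psi m) r -> forall P, ev P = 0 -> (map_poly psi P).[r] = 0.
Proof.
move=> ker psil mr P P0; pose l := lead_coef m ^+ scalp P m.
have E := Pdiv.Idomain.divp_eq P m.
have evl : ev (P %% m) = 0.
  have := congr1 ev E; rewrite rmorphD rmorphM m0 mulr0 add0r => <-.
  by rewrite -mul_polyC rmorphM P0 mulr0.
have mod0 : map_poly psi (P %% m) = 0.
  by apply: psi_map ker (mmin evl _); rewrite Pdiv.Idomain.ltn_modp.
have /= := congr1 (fun Q => (map_poly psi Q).[r]) E.
rewrite -mul_polyC rmorphM rmorphD rmorphM hornerD !hornerM /= mod0 horner0 addr0.
rewrite (eqP mr) mulr0 /= map_polyC hornerC /= rmorphXn => /eqP.
by rewrite mulf_eq0 expf_eq0 (negbTE psil) andbF => /eqP.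
Qed.

(* An element of (B, m) of minimal size among those not killed by ev is constant
   modulo the kernel of iota. *)
Let bezout B : ev B != 0 -> exists2 a0, iota a0 != 0 &
  exists U V, map_poly iota (a0%:P) = map_poly iota (U * B + V * m).
Proof.
move=> B0.
pose S W := ev W != 0 /\ exists U V, map_poly iota W = map_poly iota (U * B + V * m).
have exS : exists s, `[< exists2 W, S W & size W = s >].
  by exists (size B); apply/asboolP; exists B => //; split=> //; exists 1, 0; rewrite mul1r mul0r addr0.
case: (ex_minnP exS) => s /asboolP[W [W0 [U [V WE]]] Ws] smin.
have {}smin W' : S W' -> (size W <= size W')%N.
  by move=> SW'; rewrite Ws; apply: smin; apply/asboolP; exists W'.
have W_map : map_poly iota W != 0.
  by apply: contraNneq W0; rewrite adjoinE => ->; rewrite horner0.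
have lW : iota (lead_coef W) != 0.
  have [W' [W'E lW' W's]] := trim W_map.
  have eW : size W = size W'.
    apply/eqP; rewrite eqn_leq W's andbT; apply: smin; split.
      by rewrite adjoinE W'E -adjoinE.
    by exists U, V; rewrite W'E.
  by move: lW'; rewrite !lead_coefE eW -!coef_map /= W'E.
have Wn0 : W != 0 by apply: contraNneq W_map => ->; rewrite rmorph0.
(* Pseudo-division of W by m stays in the ideal and is still not killed by [ev], so minimality
   bounds W by the remainder. *)
have Wm : (size W < size m)%N.
  apply: (@leq_ltn_trans (size (W %% m))); last by rewrite Pdiv.Idomain.ltn_modp.
  have E := Pdiv.Idomain.divp_eq W m; apply: smin; split.
    have := congr1 ev E; rewrite rmorphD rmorphM m0 mulr0 add0r -mul_polyC rmorphM => <-.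
    by rewrite mulf_neq0 // adjoinE map_polyC hornerC /= rmorphXn expf_neq0.
  exists ((lead_coef m ^+ scalp W m)%:P * U), ((lead_coef m ^+ scalp W m)%:P * V - W %/ m).
  rewrite mulrBl addrA -!mulrA -mulrDr rmorphB rmorphM /= -WE -rmorphM -rmorphB mul_polyC E.
  by rewrite addrC addKr.
(* Otherwise divide m by W. The remainder is too short to survive, then so is the quotient, and a
   multiple of m by a nonzero scalar of K would vanish over K. *)
have W1 : (size W <= 1)%N.
  rewrite leqNgt; apply/negP => W2.
  have E := Pdiv.Idomain.divp_eq m W.
  have modS : ev (m %% W) = 0.
    apply: contrapT => /eqP mW.
    suff: (size W <= size (m %% W)%R)%N by rewrite leqNgt Pdiv.Idomain.ltn_modp Wn0.
    apply: smin; split=> //.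
    exists (- (m %/ W) * U), ((lead_coef W ^+ scalp m W)%:P - m %/ W * V).
    set Q := m %/ W in E *; set l := _ ^+ _ in E *.
    rewrite (_ : - Q * U * B + (l%:P - Q * V) * m = l%:P * m - Q * (U * B + V * m)); last by ring.
    rewrite rmorphB [X in _ - X]rmorphM /= -WE -rmorphM -rmorphB mul_polyC E.
    by rewrite addrC addKr.
  have modm : map_poly iota (m %% W) = 0.
    by apply: mmin => //; apply: leq_trans (ltnW Wm); rewrite Pdiv.Idomain.ltn_modp.
  have div0 : ev (m %/ W) = 0.
    have := congr1 ev E; rewrite rmorphD rmorphM modS addr0 -mul_polyC rmorphM m0 mulr0 => /esym/eqP.
    by rewrite mulf_eq0 (negbTE W0) orbF => /eqP.
  have divm : map_poly iota (m %/ W) = 0.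
    apply: mmin => //; rewrite Pdiv.Idomain.size_divp //.
    by move: (size_poly_gt0 m); rewrite m_neq0; move: (size m) (size W) W2 => x y; lia.
  have := congr1 (map_poly iota) E; rewrite rmorphD rmorphM /= divm mul0r modm addr0.
  rewrite -mul_polyC rmorphM /= map_polyC => /eqP.
  have lWk : iota (lead_coef W ^+ scalp m W) != 0 by rewrite rmorphXn expf_neq0.
  by rewrite mulf_eq0 (negbTE m_map) orbF polyC_eq0 (negbTE lWk).
have WC := size1_polyC W1; exists W`_0; last by exists U, V; rewrite -WC.
by apply: contraNneq W_map => W00; rewrite WC map_polyC /= W00.
Qed.

(** X is sent to a root r of the image of m. Avoiding the leading coefficient of m makes this well
    defined; avoiding a0 = U B + V m keeps B nonzero at r. *)
Lemma specializable_algebraic : specializable ev.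
Proof.
move=> B B0; have [a0 a00 [U [V E]]] := bezout B0.
have la : iota (a0 * lead_coef m) != 0 by rewrite rmorphM mulf_neq0.
have [a apos Ha] := sD la; exists a => // L aL; have [psi [ker]] := Ha L aL.
rewrite rmorphM mulf_eq0 negb_or => /andP[pa pl].
have /closed_rootP[r mr] : size (map_poly psi m) != 1.
  rewrite size_map_poly_id0 //; apply: contraNneq m_map => /eqP/size_poly1P[z z0 mz].
  have := m0; rewrite adjoinE mz map_polyC hornerC /= => ->.
  by rewrite polyC0.
exists (horner_morph (comm_c psi r)); split=> [P P0|].
  exact: (psi_root ker pl mr).
rewrite /= /horner_morph; apply: contraNneq pa => Br.
have : map_poly psi (a0%:P - (U * B + V * m)) = 0.
  by apply: (psi_map ker); rewrite rmorphB /= E subrr.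
move=> /(congr1 (fun Q : {poly L} => Q.[r])).
rewrite rmorphB rmorphD !rmorphM hornerD hornerN hornerD !hornerM /= Br (eqP mr) !mulr0.
by rewrite addr0 subr0 map_polyC hornerC horner0 => ->.
Qed.

End Algebraic.

Lemma specializable_adjoin : specializable ev.
Proof.
have [tr|] := pselect (forall P, ev P = 0 -> map_poly iota P = 0).
  exact: specializable_transcendental.
move=> /existsNP[P0 /not_implyP[eP0 mP0]].
(* A shortest such P plays the role of the minimal polynomial of c over D. *)
pose S s := `[< exists P, [/\ ev P = 0, map_poly iota P != 0 & size P = s] >].
have exS : exists s, S s.
  by exists (size P0); apply/asboolP; exists P0; split=> //; apply/eqP.
case: (ex_minnP exS) => s /asboolP[P [eP mP Ps]] smin.
have [m [mE lm ms]] := trim mP.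
have em : ev m = 0 by rewrite adjoinE mE -adjoinE.
apply: (specializable_algebraic em lm) => Q Q0 Qm.
apply: contrapT => /eqP mQ; have : S (size Q) by apply/asboolP; exists Q.
by move=> /smin; rewrite -Ps leqNgt (leq_trans Qm ms).
Qed.

End Adjoin.

(** D is an iterated polynomial ring over the integers. Relations among the elements of s stay in
    the kernel of [iota] and are never divided out. *)
Lemma specializable_seq (s : seq K) : [pchar K] =i pred0 ->
  exists (D : idomainType) (iota : {rmorphism D -> K}),
    specializable iota /\ forall c, c \in s -> exists z, iota z = c.
Proof.
move=> K0; elim: s => [|c s [D [iota [sD Ds]]]].
  by exists int, (intr : {rmorphism int -> K}); split=> //; exact: specializable_int.
exists {poly D}, (adjoin iota c); split; first exact: specializable_adjoin.
move=> x; rewrite inE => /orP[/eqP ->|/Ds[z <-]].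
  by exists 'X; rewrite adjoinE map_polyX hornerX.
by exists z%:P; rewrite adjoinE map_polyC hornerC.
Qed.

Lemma specialization (s : seq K) : [pchar K] =i pred0 ->
  exists (D : idomainType) (iota : {rmorphism D -> K}) (L : closedFieldType)
    (psi : {rmorphism D -> L}) (p : nat),
  [/\ p \in [pchar L], forall z, iota z = 0 -> psi z = 0 &
      forall c, c \in s -> exists z, iota z = c].
Proof.
move=> K0; have [D [iota [sD Ds]]] := specializable_seq s K0.
have [a a0 Ha] := sD 1 ltac:(by rewrite rmorph1 oner_neq0).
have [p ap pp] := prime_above a.
have [L [FL _]] := countable_algebraic_closure 'F_p.
have pL : p \in [pchar L].
  rewrite inE pp /=; have := pchar_Fp pp; rewrite inE => /andP[_ /eqP p0].
  by rewrite -(rmorph_nat FL) p0 rmorph0.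
have aL : a%:R != 0 :> L.
  by rewrite -(dvdn_pcharf pL) gtnNdvd.
have [psi [ker _]] := Ha L aL.
by exists D, iota, L, psi, p.
Qed.

End Specializable.

(** * Transfer from characteristic 0 *)

Section Congruence.
Variables (n : nat) (K : comNzRingType) (M : nat).
Local Notation R := (mfps n K).
Implicit Types u v : R.

Definition cong u v : Prop := order_ge M (u - v).

Lemma cong_refl u : cong u u.
Proof. by move=> m _; rewrite subrr. Qed.

Lemma cong_trunc u : cong (trunc M u) u.
Proof.
by move=> m md; rewrite mfps_coefB coef_trunc md subrr.
Qed.

Lemma congB u u' v v' : cong u u' -> cong v v' -> cong (u - v) (u' - v').
Proof.
move=> uu vv; rewrite /cong (_ : _ - _ = (u - u') - (v - v')); last by ring.
exact: (idealB (order_ge_ideal n K M)).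
Qed.

Lemma congM u u' v v' : cong u u' -> cong v v' -> cong (u * v) (u' * v').
Proof.
move=> uu vv; rewrite /cong (_ : _ - _ = v * (u - u') + u' * (v - v')); last by ring.
by have [_ OD OM] := order_ge_ideal n K M; apply: OD; exact: OM.
Qed.

Lemma congX u v k : cong u v -> cong (u ^+ k) (v ^+ k).
Proof.
move=> uv; elim: k => [|k IHk]; first exact: cong_refl.
by rewrite !exprS; exact: congM.
Qed.

Lemma cong_sum (T : finType) (F G : T -> R) :
  (forall t, cong (F t) (G t)) -> cong (\sum_t F t) (\sum_t G t).
Proof.
move=> FG; rewrite /cong -sumrB; apply: (ideal_sum _ (order_ge_ideal n K M)) => t _.
exact: FG.
Qed.

Lemma cong_mons (T : finType) (h h' : T -> R) s (a : exps T s) :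
  (forall t, cong (h t) (h' t)) -> cong (mons h a) (mons h' a).
Proof.
move=> hh; rewrite /mons; elim/big_rec2: _ => [|t u v _ uv]; first exact: cong_refl.
by apply: congM => //; exact: congX.
Qed.

Lemma cong_coef u v (b : bmultinom n M) : cong u v -> mfps_coef u b = mfps_coef v b.
Proof.
by move=> uv; apply/eqP; rewrite -subr_eq0 -mfps_coefB; apply/eqP/uv; exact: bmdeg.
Qed.

Lemma cong_order_ge u v : order_ge M v -> cong u v -> order_ge M u.
Proof.
by move=> v0 uv; rewrite -[u](subrK v); have [_ + _] := order_ge_ideal n K M; apply.
Qed.

End Congruence.

Section Functionals.
Variables (n : nat) (K : fieldType) (M : nat).
Local Notation R := (mfps n K).
Local Notation B := (bmultinom n M).

Definition functional (pi : B -> K) (v : R) : K := \sum_(b : B) mfps_coef v b * pi b.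

Lemma functionalZ pi c v : functional pi (c *: v) = c * functional pi v.
Proof. by rewrite mulr_sumr; apply: eq_bigr => b _; rewrite mfps_coefZ mulrA. Qed.

Lemma functionalD pi u v : functional pi (u + v) = functional pi u + functional pi v.
Proof. by rewrite -big_split; apply: eq_bigr => b _; rewrite mfps_coefD mulrDl. Qed.

Lemma functional_sum pi (T : finType) (F : T -> R) :
  functional pi (\sum_t F t) = \sum_t functional pi (F t).
Proof.
apply: (big_morph (functional pi)); first exact: functionalD.
by rewrite /functional big1 // => b _; rewrite mfps_coef0 mul0r.
Qed.

Lemma functional_cong pi u v : cong M u v -> functional pi u = functional pi v.
Proof. by move=> uv; apply: eq_bigr => b _; rewrite (cong_coef b uv). Qed.

Lemma functional_idl pi (T : finType) (g : T -> R) :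
  (forall t (b : B), functional pi (monomial K b * g t) = 0) ->
  forall v, idl g v -> functional pi v = 0.
Proof.
move=> pig v [c ->]; rewrite functional_sum big1 // => t _.
rewrite -(functional_cong pi (congM (cong_trunc (c t)) (cong_refl (g t)))).
rewrite mulr_suml functional_sum big1 // => b _.
by rewrite -scalerAl functionalZ pig mulr0.
Qed.

Lemma functional_indep (I : set R) (T : finType) (pi : T -> B -> K) (e : T -> R) :
  (forall t v, I v -> functional (pi t) v = 0) ->
  (forall t t', functional (pi t) (e t') = (t == t')%:R) -> indep I e.
Proof.
move=> piI pie c Ic t; have := piI t _ Ic; rewrite functional_sum (bigD1 t) //=.
rewrite functionalZ pie eqxx mulr1 big1 ?addr0 // => t' t't.
by rewrite functionalZ pie eq_sym (negbTE t't) mulr0.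
Qed.

(** These are the coordinate forms of the basis, given by the coordinates of the monomials. They
    certify independence by finitely many equations over K, a form that specializes. *)
Lemma basis_functionals (I : set R) (T : finType) (e : T -> R) :
  is_ideal I -> order_ge M `<=` I -> spans I e -> indep I e ->
  exists pi : T -> B -> K, (forall t v, I v -> functional (pi t) v = 0) /\
    (forall t t', functional (pi t) (e t') = (t == t')%:R).
Proof.
move=> iI MI se ie.
have /choice[k Hk] (b : B) := se (monomial K b); exists (fun t b => k b t).
have Hv v : I (v - \sum_t functional (fun b => k b t) v *: e t).
  have -> : v - \sum_t functional (fun b => k b t) v *: e t = (v - trunc M v)
      + \sum_(b : B) mfps_coef v b *: (monomial K b - \sum_t k b t *: e t).
    under [in RHS]eq_bigr do rewrite scalerBr scaler_sumr.
    rewrite sumrB addrA subrK exchange_big; congr (_ - _); apply: eq_bigr => t _.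
    by rewrite /functional scaler_suml; apply: eq_bigr => b _; rewrite scalerA.
  case: (iI) => _ ID _; apply: ID; first by apply: MI; exact: trunc_order.
  by apply: ideal_sum => // b _; exact: idealZ.
split=> [t v Iv|t t'].
  apply: (ie (fun t => functional (fun b => k b t) v)).
  by rewrite -[X in I X](subKr v); exact: idealB.
apply/eqP; rewrite -subr_eq0; apply/eqP.
apply: (ie (fun t => functional (fun b => k b t) (e t') - (t == t')%:R)).
under eq_bigr do rewrite scalerBl; rewrite sumrB.
rewrite [X in _ - X](bigD1 t') //= eqxx scale1r [X in _ - (_ + X)]big1 ?addr0.
  by rewrite -opprB; apply: idealN.
by move=> s /negbTE ->; rewrite scale0r.
Qed.

End Functionals.

Section Transfer.
Variables (n : nat) (K : fieldType) (D : idomainType) (L : fieldType).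
Variables (iota : {rmorphism D -> K}) (psi : {rmorphism D -> L}) (M : nat).
Hypothesis ker : forall z, iota z = 0 -> psi z = 0.

Lemma order_ge_map (u : mfps n D) :
  order_ge M (map_mfps iota u) -> order_ge M (map_mfps psi u).
Proof. by move=> iu m md; apply: ker; exact: iu. Qed.

Lemma lift_family (X : finType) (F : X -> mfps n K) :
  (forall x (b : bmultinom n M), exists z, iota z = mfps_coef (F x) b) ->
  exists F' : X -> mfps n D, forall x, cong M (map_mfps iota (F' x)) (F x).
Proof.
move=> HF; have /choice[c Hc] (y : X * bmultinom n M) := HF y.1 y.2.
exists (fun x => \sum_(b : bmultinom n M) c (x, b) *: monomial D b) => x m md.
rewrite rmorph_sum mfps_coefB mfps_coef_sum (bigD1 (BMultinom md)) //= big1 => [|b].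
  by rewrite eqxx mulr1 addr0 Hc subrr.
by rewrite bmeqP eq_sym /= => /negbTE ->; rewrite mulr0 rmorph0.
Qed.

Lemma lift_scalars (X : finType) (c : X -> K) :
  (forall x, exists z, iota z = c x) -> exists c' : X -> D, forall x, iota (c' x) = c x.
Proof. by move=> /choice[c' ?]; exists c'. Qed.

Lemma map_mons (A B : comNzRingType) (phi : {rmorphism A -> B}) (T : finType)
    (h : T -> mfps n A) s (a : exps T s) :
  map_mfps phi (mons h a) = mons (fun t => map_mfps phi (h t)) a.
Proof. by rewrite rmorph_prod; apply: eq_bigr => t _; rewrite rmorphXn. Qed.

Lemma map_mul_mons (A B : comNzRingType) (phi : {rmorphism A -> B}) (T : finType)
    (u : mfps n A) (h : T -> mfps n A) s (a : exps T s) :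
  map_mfps phi (u * mons h a) = map_mfps phi u * mons (fun t => map_mfps phi (h t)) a.
Proof. by rewrite rmorphM -map_mons. Qed.

Lemma map_residual (A B : comNzRingType) (phi : {rmorphism A -> B}) (X : finType)
    (u : mfps n A) (F G : X -> mfps n A) :
  map_mfps phi (u - \sum_x F x * G x) =
  map_mfps phi u - \sum_x map_mfps phi (F x) * map_mfps phi (G x).
Proof.
rewrite rmorphB rmorph_sum; congr (_ - _); apply: eq_bigr => x _.
by rewrite rmorphM.
Qed.

(** Over D the residual has, below degree M, only coefficients killed by [iota]; psi kills them
    too. *)
Lemma transfer_combination (X : finType) (u : mfps n D) (F G : X -> mfps n D)
    (u0 : mfps n K) (F0 G0 : X -> mfps n K) :
  cong M (map_mfps iota u) u0 -> (forall x, cong M (map_mfps iota (F x)) (F0 x)) ->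
  (forall x, cong M (map_mfps iota (G x)) (G0 x)) -> u0 = \sum_x F0 x * G0 x ->
  cong M (map_mfps psi u) (\sum_x map_mfps psi (F x) * map_mfps psi (G x)).
Proof.
move=> uu FF GG uE; rewrite /cong -map_residual; apply: order_ge_map.
rewrite map_residual; apply: (@cong_order_ge _ _ _ _ (u0 - \sum_x F0 x * G0 x)).
  by rewrite uE subrr; case: (order_ge_ideal n K M).
by apply: congB => //; apply: cong_sum => x; exact: congM.
Qed.

Lemma transfer_functional (v : mfps n D) (v0 : mfps n K) (pi : bmultinom n M -> D)
    (pi0 : bmultinom n M -> K) (k : bool) :
  cong M (map_mfps iota v) v0 -> (forall b, iota (pi b) = pi0 b) ->
  functional pi0 v0 = k%:R -> functional (fun b => psi (pi b)) (map_mfps psi v) = k%:R.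
Proof.
move=> vv pipi E; apply/eqP; rewrite -subr_eq0; apply/eqP.
pose z := \sum_(b : bmultinom n M) mfps_coef v b * pi b - k%:R.
have Ei : iota z = functional pi0 v0 - k%:R.
  rewrite /z rmorphB rmorph_nat rmorph_sum -(functional_cong pi0 vv); congr (_ - _).
  by apply: eq_bigr => b _; rewrite rmorphM pipi.
have <- : psi z = functional (fun b => psi (pi b)) (map_mfps psi v) - k%:R.
  rewrite /z rmorphB rmorph_nat rmorph_sum; congr (_ - _).
  by apply: eq_bigr => b _; rewrite rmorphM.
by apply: ker; rewrite Ei E subrr.
Qed.

End Transfer.

Ltac mem_codom_cat t := rewrite !mem_cat;
  repeat (apply/orP; first [left; exact: (codom_f _ t) | right]);
  try exact: (codom_f _ t).

Theorem char_0_bound (R : realType) (m : nat) (K : fieldType)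
    (g : 'I_m.+1 -> mfps m.+1 K) (f : mfps m.+1 K) (d N : nat)
    (T S : finType) (E : T -> mfps m.+1 K) (U : S -> mfps m.+1 K) :
  [pchar K] =i pred0 ->
  let I := idl (fun i => oapp g f i) in
  order_ge N `<=` idl g -> spans (idl g) E -> indep (idl g) E -> spans I U ->
  ideal_mul (idl g) (ipow I d) (f ^+ d.+1) ->
  #|T|%:R * mid_vol R m.+1 <= #|S|%:R.
Proof.
move=> K0 I NJ sE iE sU fd; pose h i := oapp g f i.
(* M >= N+1 lets Nakayama recover m^N inside the specialized J from equations modulo m^M; M >=
   (d+1)N then puts m^M inside J^(d+1), hence inside J I^d. *)
pose M := (d.+1 * N + N.+1)%N; pose B := bmultinom m.+1 M; pose n := m.+1.
have [pi [piJ piE]] : exists pi : T -> B -> K,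
    (forall t v, idl g v -> functional (pi t) v = 0) /\
    (forall t t', functional (pi t) (E t') = (t == t')%:R).
  apply: basis_functionals => //; first exact: idl_ideal.
  by move=> v Mv; apply: NJ; apply: order_ge_le Mv; rewrite /M; lia.
have /choice[w Hw] (b : B) : exists w : 'I_n -> mfps n K,
    (N <= mdeg b)%N -> monomial K b = \sum_i w i * g i.
  have [Nb|_] := leqP N (mdeg b); last by exists (fun=> 0).
  have [w Hw] : idl g (monomial K b) by apply/NJ/(order_ge_le Nb)/monomial_order.
  by exists w.
move: (fd); rewrite ipow_idl idl_mul => -[r Hr].
have /choice[c Hc] (b : B) := sU (monomial K b).
have /choice[y Hy] := Hc.
(* All scalars in the certificates: w for m^N in J, r for the reduction, c and y for spanning by U,
   pi for independence of E. *)
pose cs := codom (fun x : 'I_n * B => mfps_coef (g x.1) x.2) ++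
  codom (fun b : B => mfps_coef f b) ++
  codom (fun x : B * 'I_n * B => mfps_coef (w x.1.1 x.1.2) x.2) ++
  codom (fun x : 'I_n * exps (option 'I_n) d * B => mfps_coef (r x.1) x.2) ++
  codom (fun x : T * B => mfps_coef (E x.1) x.2) ++
  codom (fun x : S * B => mfps_coef (U x.1) x.2) ++
  codom (fun x : B * option 'I_n * B => mfps_coef (y x.1.1 x.1.2) x.2) ++
  codom (fun x : T * B => pi x.1 x.2) ++ codom (fun x : B * S => c x.1 x.2).
have [D [iota [L [psi [p [pL ker Dcs]]]]]] := specialization cs K0.
pose ci := @map_mfps n D K iota; pose cp := @map_mfps n D L psi.
have [g' Hg'] : exists g' : 'I_n -> mfps n D, forall i, cong M (ci (g' i)) (g i).
  by apply: lift_family => i b; apply: Dcs; mem_codom_cat (i, b).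
have [f' /(_ tt) Hf'] : exists f' : unit -> mfps n D, forall i, cong M (ci (f' i)) f.
  by apply: lift_family => i b; apply: Dcs; mem_codom_cat b.
have [w' Hw'] : exists w' : B * 'I_n -> mfps n D, forall x, cong M (ci (w' x)) (w x.1 x.2).
  by apply: lift_family => x b; apply: Dcs; mem_codom_cat (x, b).
have [r' Hr'] : exists r' : 'I_n * exps (option 'I_n) d -> mfps n D,
    forall x, cong M (ci (r' x)) (r x).
  by apply: lift_family => x b; apply: Dcs; mem_codom_cat (x, b).
have [E' HE'] : exists E' : T -> mfps n D, forall t, cong M (ci (E' t)) (E t).
  by apply: lift_family => x b; apply: Dcs; mem_codom_cat (x, b).
have [U' HU'] : exists U' : S -> mfps n D, forall t, cong M (ci (U' t)) (U t).
  by apply: lift_family => x b; apply: Dcs; mem_codom_cat (x, b).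
have [y' Hy'] : exists y' : B * option 'I_n -> mfps n D, forall x, cong M (ci (y' x)) (y x.1 x.2).
  by apply: lift_family => x b; apply: Dcs; mem_codom_cat (x, b).
have [pi' Hpi'] : exists pi' : T * B -> D, forall x, iota (pi' x) = pi x.1 x.2.
  by apply: lift_scalars => x; apply: Dcs; mem_codom_cat x.
have [c' Hc'] : exists c' : B * S -> D, forall x, iota (c' x) = c x.1 x.2.
  by apply: lift_scalars => x; apply: Dcs; mem_codom_cat x.
move: {f'} (f' tt) Hf' => f' Hf'.
pose h' i := oapp g' f' i.
have Hh' i : cong M (ci (h' i)) (h i) by case: i => [i|] /=.
pose G i := cp (g' i); pose F := cp f'; pose H i := oapp G F i.
have HE i : H i = cp (h' i) by case: i.
have MG b : (N <= mdeg (b : B))%N -> cong M (monomial L b) (\sum_i cp (w' (b, i)) * G i).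
  move=> Nb; rewrite -(map_monomial psi); apply: (transfer_combination ker) (Hw b Nb) => //.
  by rewrite map_monomial; exact: cong_refl.
have NG : order_ge N `<=` idl G.
  rewrite order_ge_mons; apply: nakayama; first exact: idl_ideal.
  rewrite -order_ge_mons => v Nv.
  rewrite -[v](subrK (trunc M v)) addrC.
  have iO := @ideal_mul_ideal _ (order_ge 1) _ (order_ge_ideal n L N).
  have iZ := ideal_add_ideal (idl_ideal G) iO.
  have MZ : order_ge M `<=` ideal_add (idl G) (ideal_mul (order_ge 1) (order_ge N)).
    move=> z Mz; apply: ideal_addr; first exact: idl_ideal.
    have : order_ge N.+1 z by apply: order_ge_le Mz; rewrite /M leq_addl.
    rewrite !order_ge_ipow -add1n; exact: ipow_split.
  have [_ ZD _] := iZ; apply: ZD; last by apply: MZ; exact: trunc_order.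
  apply: ideal_sum => // b _.
  have [Nb|bN] := leqP N (mdeg b); last first.
    by rewrite Nv // scale0r; case: iZ.
  apply: idealZ => //; rewrite -[monomial L b](subrK (\sum_i cp (w' (b, i)) * G i)).
  have [_ ZD _] := iZ; apply: ZD; first by apply: MZ; exact: MG.
  by apply: ideal_addl => //; exists (fun i => cp (w' (b, i))).
have MJI : order_ge M `<=` ideal_mul (idl G) (ipow (idl H) d).
  move=> v Mv; have : ipow (idl G) d.+1 v.
    have : order_ge (d.+1 * N) v by apply: order_ge_le Mv; rewrite /M leq_addr.
    rewrite order_ge_ipow => /ipow_mul; apply: ipow_sub; rewrite -order_ge_ipow.
    exact: NG.
  apply: ideal_mul_min; first exact/ideal_mul_ideal/ipow_ideal.
  move=> a b Ga db; apply: ideal_mulI => //; move: db; apply: ipow_sub.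
  apply: idl_min; first exact: idl_ideal.
  by move=> i; exact: (idl_gen H (Some i)).
have FG : ideal_mul (idl G) (ipow (idl H) d) (F ^+ d.+1).
  have iZ := @ideal_mul_ideal _ (idl G) _ (ipow_ideal (idl H) d).
  rewrite -[F ^+ _](subrK (\sum_x cp (r' x) * (G x.1 * mons H x.2))).
  have [_ ZD _] := iZ; apply: ZD; last first.
    by rewrite ipow_idl idl_mul; exists (fun x => cp (r' x)).
  have HEf : H = (fun t => cp (h' t)) by apply/funext => t; exact: HE.
  have GH (x : 'I_n * exps (option 'I_n) d) : cp (g' x.1 * mons h' x.2) = G x.1 * mons H x.2 by rewrite HEf -map_mul_mons.
  rewrite -(eq_bigr _ (fun x _ => congr1 (fun z => cp (r' x) * z) (GH x))).
  have -> : F ^+ d.+1 = cp (f' ^+ d.+1) by rewrite /cp rmorphXn.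
  apply: MJI; apply: (transfer_combination ker) Hr => [|x|x].
  - by rewrite rmorphXn; exact: congX.
  - exact: Hr'.
  - rewrite map_mul_mons; apply: congM; first exact: Hg'.
    by apply: cong_mons => i; exact: Hh'.
have UI : spans (idl H) (fun s => cp (U' s)).
  move=> v; exists (fun s => \sum_(b : B) mfps_coef v b * psi (c' (b, s))).
  have iH := idl_ideal H; have [_ HD _] := iH.
  have GH : idl G `<=` idl H.
    by apply: (idl_min iH) => i; exact: (idl_gen H (Some i)).
  have MH : order_ge M `<=` idl H.
    by move=> z Mz; apply/GH/NG; apply: order_ge_le Mz; rewrite /M; lia.
  have -> : v - \sum_s (\sum_(b : B) mfps_coef v b * psi (c' (b, s))) *: cp (U' s) =
      (v - trunc M v) + \sum_(b : B) mfps_coef v b *: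
        (monomial L b - \sum_s psi (c' (b, s)) *: cp (U' s)).
    under [in RHS]eq_bigr do rewrite scalerBr scaler_sumr.
    rewrite sumrB addrA subrK exchange_big; congr (_ - _); apply: eq_bigr => t _.
    by rewrite scaler_suml; apply: eq_bigr => b _; rewrite scalerA.
  apply: (HD); first by apply: MH; exact: trunc_order.
  apply: ideal_sum => // b _; apply: idealZ => //.
  rewrite -[X in idl H X](subrK (\sum_o cp (y' (b, o)) * H o)).
  apply: (HD); last by exists (fun o => cp (y' (b, o))).
  apply: MH.
  have -> : monomial L b - \sum_s psi (c' (b, s)) *: cp (U' s) =
      cp (monomial D b - \sum_s (c' (b, s))%:A * U' s).
    rewrite /cp map_residual map_monomial; congr (_ - _); apply: eq_bigr => s _.
    by rewrite map_mfpsZ rmorph1 -scalerAl mul1r.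
  have -> : \sum_o cp (y' (b, o)) * H o = \sum_o cp (y' (b, o)) * cp (h' o).
    by apply: eq_bigr => o _; rewrite HE.
  rewrite -/(cong M _ _); apply: (transfer_combination ker) (Hy b) => [|o|o]; last 2 first.
  - exact: Hy'.
  - exact: Hh'.
  rewrite map_residual map_monomial; apply: congB; first exact: cong_refl.
  apply: cong_sum => s; rewrite map_mfpsZ Hc' rmorph1 -[X in cong _ _ (_ *: X)]mul1r scalerAl.
  by apply: congM; [exact: cong_refl|exact: HU'].
have iE' : indep (idl G) (fun t => cp (E' t)).
  apply: (functional_indep (pi := fun t b => psi (pi' (t, b)))) => [t|t t'].
    apply: functional_idl => i b; rewrite -(map_monomial psi) -[_ * _]rmorphM.
    apply: (transfer_functional ker (k := false) (v0 := monomial K b * g i) (pi0 := pi t)) => //=.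
    - by rewrite rmorphM /= map_monomial; apply: congM => //; exact: cong_refl.
    - by apply: piJ; have [_ _] := idl_ideal g; apply; exact: idl_gen.
  exact: (transfer_functional ker (v0 := E t') (pi0 := pi t)).
have sJ : subspace (idl G).
  split=> [|a u v]; first by case: (idl_ideal G).
  exact: (ideal_subspace _ (idl_ideal G)).
have sG : spans (idl G) (fun b : B => monomial L b).
  move=> v; exists (fun b : B => mfps_coef v b); apply: NG.
  by apply: (@order_ge_le _ _ N M); [rewrite /M; lia|exact: trunc_order].
(* Only independence of E was transported, so the specialized colength mu may exceed #|T|. The
   inequality goes the right way because the volume is positive. *)
have [mu [e /(quot_basisP _ sJ)[se ie]]] := spans_basis sJ sG.
have Tmu : (#|T| <= mu)%N by rewrite -[mu]card_ord; exact: indep_spans_leq sJ iE' se.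
apply: (@le_trans _ _ (mu%:R * mid_vol R m.+1)).
  by rewrite ler_wpM2r ?ler_nat // ltW // mid_vol_gt0.
rewrite -[mu]card_ord; apply: (char_p_bound _ pL _ se ie UI FG).
move=> x; have /closed_rootP[z] : size ('X^p - x%:P) != 1.
  have p1 : (1 < p)%N by case/andP: pL => /prime_gt1.
  rewrite size_XnsubC ?(ltnW p1) //; by case: p p1 {pL} => [|[]].
by rewrite rootE !hornerE subr_eq0 => /eqP; exists z.
Qed.

(** * Jacobian and Tjurina ideals, and the final inequality *)

Lemma infinite_of_char_0 (K : fieldType) (P : {poly K}) :
  [pchar K] =i pred0 -> P != 0 -> exists x, P.[x] != 0.
Proof.
move=> K0 P0; apply: contrapT => noroot.
have rP : all (root P) [seq k%:R | k <- iota 0 (size P)].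
  apply/allP => x _; apply: contrapT => /negP rx; apply: noroot; by exists x.
have uP : uniq [seq (k%:R : K) | k <- iota 0 (size P)].
  rewrite map_inj_uniq ?iota_uniq //.
  have le i j : (i <= j)%N -> i%:R = j%:R :> K -> i = j.
    move=> ij E; apply/eqP; rewrite eqn_leq ij -subn_eq0 -((pcharf0P K).1 K0).
    by rewrite natrB // E subrr eqxx.
  by move=> i j ij; have [/le|/ltnW/le] := leqP i j; [apply|move=> /(_ (esym ij)) ->].
by have := max_poly_roots P0 rP uP; rewrite size_map size_iota ltnn.
Qed.

Lemma tjac_idl n (K : fieldType) (f : mfps n K) :
  tjac f = idl (oapp (fun i => mfps_deriv i f) f).
Proof.
have iI := idl_ideal (oapp (fun i => mfps_deriv i f) f).
rewrite eqEsubset; split.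
- move=> _ [_ [c ->] [b jb <-]]; have [_ ID IM] := iI; apply: ID.
    by rewrite big_ord1 /=; apply: IM; exact: (idl_gen _ None).
  move: jb; rewrite /jac ideal_gen_idl; apply: idl_min => // i.
  exact: (idl_gen _ (Some i)).
- have iJ : is_ideal (jac f) by rewrite /jac ideal_gen_idl; exact: idl_ideal.
  have iF : is_ideal (ideal_gen [:: f]).
    split.
    + by exists (fun=> 0); rewrite big1 // => i _; rewrite mul0r.
    + move=> _ _ [a ->] [b ->]; exists (fun i => a i + b i).
      by rewrite -big_split; apply: eq_bigr => i _; rewrite mulrDl.
    + move=> x _ [a ->]; exists (fun i => x * a i).
      by rewrite mulr_sumr; apply: eq_bigr => i _; rewrite mulrA.
  apply: idl_min; first exact: ideal_add_ideal.
  case=> [i|] /=; last by apply: ideal_addl => //; exists (fun=> 1); rewrite big_ord1 mul1r.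
  apply: ideal_addr => //; rewrite /jac ideal_gen_idl.
  exact: (idl_gen (fun i => mfps_deriv i f)).
Qed.

Lemma singularity_order n (K : fieldType) (f : mfps n K) :
  hypersurface_singularity f -> order_ge 2 f.
Proof.
have m1 : @maxideal n K = order_ge 1.
  by rewrite /maxideal ideal_gen_idl order_ge_ipow ipow1 //; exact: idl_ideal.
rewrite /hypersurface_singularity m1; apply: ideal_mul_min.
  exact: order_ge_ideal.
by move=> a b a1 b1; rewrite -[2%N]/(1 + 1)%N; exact: order_geM.
Qed.

Theorem theorem1p4 (R : realType) (n : nat) (hn : (1 <= n)%N) (K : fieldType)
    (hK : forall p : nat, p \in [pchar K] -> GRing.closed_field_axiom K)
    (f : mfps n K) (hf : isolated_singularity R f) :
  (gen_milnor R f / tjurina R f <=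
     (1 / (cube_vol n ((n%:R + 1) / 2) - cube_vol n ((n%:R - 1) / 2)))%:E)%E.
Proof.
case: n hn f hf => // m _ f [fm tf]; rewrite -/(mid_vol R m.+1).
pose I := idl (oapp (fun i => mfps_deriv i f) f).
have iI : is_ideal I by exact: idl_ideal.
have sI : subspace I.
  split=> [|a u v]; first by case: iI.
  exact: (ideal_subspace _ iI).
have [tau [U BU]] : exists d (e : 'I_d -> mfps m.+1 K), quot_basis I e.
  apply: contrapT => nb; move: tf; rewrite /tjurina /quot_dim tjac_idl.
  by case: pselect => // _; rewrite ltxx.
have tauE : tjurina R f = (tau%:R)%:E.
  by rewrite /tjurina tjac_idl; apply: quot_dimE BU; case: sI.
have /(quot_basisP _ sI)[sU iU] := BU.
have I1 : I `<=` order_ge 1.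
  have f2 := singularity_order fm; apply: idl_min; first exact: order_ge_ideal.
  case=> [i|] /=; last exact: order_ge_le f2.
  by apply/order_ge1E; rewrite /= f2 ?mul0rn // mdegD mdeg0 mdeg1.
(* As f lies in m^2, f and its derivatives lie in m, so 1 is not in I. *)
have tau0 : 0 < tau%:R :> R.
  rewrite ltr0n lt0n; apply/eqP => t0; have [c] := sU 1.
  rewrite big1 ?subr0 => [/I1/order_ge1E|[i ilt] _]; last by exfalso; move: ilt; rewrite t0.
  by rewrite mfps_coef1 eqxx; apply/eqP; exact: oner_neq0.
have Kinf P : P != 0 -> exists x : K, P.[x] != 0.
  move=> P0; have [[p pK]|np] := pselect (exists p, p \in [pchar K]).
    by have /(PreClosedField.closed_nonrootP (hK p pK)) := P0.
  apply: infinite_of_char_0 => // p; apply/negbTE/negP => pK; apply: np.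
  by exists p.
have [u [d [uU Ig red]]] := reduction_by_unit Kinf I1 sU.
pose g i := mfps_deriv i (u * f).
have fd : ideal_mul (idl g) (ipow I d) (f ^+ d.+1).
  by apply: red; apply: ipowX; exact: (idl_gen _ None).
have [N0 N0I] := finite_codim_order_ge iI sU.
pose N := (d.+1 * N0)%N.
(* The reduction makes the colength of J finite: m^N is in I^(d+1), hence in J I^d and in J. *)
have NJ : order_ge N `<=` idl g.
  move=> v; rewrite order_ge_ipow => /ipow_mul vN.
  apply: (@ideal_mul_subl _ _ (ipow I d)); first exact: idl_ideal.
  by apply: red; move: v vN; apply: ipow_sub; rewrite -order_ge_ipow.
have sJ : subspace (idl g).
  split=> [|a v w]; first by case: (idl_ideal g).
  exact: (ideal_subspace _ (idl_ideal g)).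
have sM : spans (idl g) (fun b : bmultinom m.+1 N => monomial K b).
  by move=> v; exists (fun b : bmultinom m.+1 N => mfps_coef v b); apply: NJ; exact: trunc_order.
have [mu [E BE]] := spans_basis sJ sM.
have muE : milnor R (u * f) = (mu%:R)%:E.
  by rewrite /milnor /jac ideal_gen_idl; apply: quot_dimE BE; case: sJ.
have /(quot_basisP _ sJ)[sE iE] := BE.
have bound : mu%:R * mid_vol R m.+1 <= tau%:R.
  have IgI : idl (oapp g f) = I by exact: Ig.
  (* The bounds expect I to be generated by f and the g_i instead of f and its own derivatives. *)
  rewrite -IgI in sU fd; rewrite -[mu]card_ord -[tau]card_ord.
  have [[p pK]|np] := pselect (exists p, p \in [pchar K]).
    apply: (char_p_bound _ pK _ sE iE sU fd) => x.
    have p1 : (1 < p)%N by case/andP: pK => /prime_gt1.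
    have /(PreClosedField.closed_rootP (hK p pK))[z] : size ('X^p - x%:P) != 1.
      by rewrite size_XnsubC ?(ltnW p1) //; case: p p1 {pK} => [|[]].
    by rewrite rootE !hornerE subr_eq0 => /eqP; exists z.
  apply: (char_0_bound _ _ NJ sE iE sU fd) => p.
  by apply/negbTE/negP => pK; apply: np; exists p.
have V0 := mid_vol_gt0 R m.
(* The generalized Milnor number is at most the Milnor number of this particular [u * f]. *)
rewrite tauE inver gt_eqF //; apply: (@le_trans _ _ ((mu%:R)%:E * (tau%:R^-1)%:E)%E).
  apply: lee_wpmul2r; first by rewrite lee_fin invr_ge0 ltW.
  by rewrite -muE; apply: ereal_inf_lbound; exists u.
by rewrite -EFinM lee_fin ler_pdivrMr // mul1r mulrC ler_pdivlMr.
Qed.
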